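(* Let $G$ be a locally compact second countable unimodular group with a fixed Haar measure $m_G$. For every probability preserving $G$-space $(X,\mu)$ with a locally integrable cross section $Y$, $$I_\mu(Y)\ \ge\ \iota_\mu(Y),$$ with equality if and only if there exist a lattice $\Gamma<G$ and a transverse $G$-factor from $(X,\mu,Y)$ onto $(\Gamma\backslash G,\,m_{\Gamma\backslash G},\,\{\Gamma\})$.
   Context: A Borel $G$-space is a standard Borel space $X$ with a jointly Borel action $G\times X\to X$, $(g,x)\mapsto g.x$. For $Y\subseteq X$ and $x\in X$ put $Y_x=\{g\in G: g.x\in Y\}$. A subset of $G$ is locally finite if it meets every compact set in a finite set. A cross section of a Borel $G$-space $X$ is a Borel set $Y\subseteq X$ with $Y_x$ nonempty and locally finite for every $x\in X$. A probability preserving $G$-space $(X,\mu)$ is a Borel $G$-space with a $G$-invariant Borel probability measure. A locally integrable cross section of $(X,\mu)$ is a Borel set $Y\subseteq X$ such that $G.Y$ (a Borel set) is $\mu$-conull, $Y_x$ is locally finite for all $x\in G.Y$, and $\int_X|Y_x\cap K|\,d\mu(x)<\infty$ for every compact $K\subset G$. Then $(X,\mu,Y)$ is called a transverse $G$-space. Transverse measure: let $\mu$ be a $G$-invariant $\sigma$-finite measure on a Borel $G$-space $X$ for which $Y$ is a cross section (of $X$, or of a conull invariant Borel subset). The transverse measure $\mu_Y$ on $Y$ is $$\mu_Y(f)=\int_X\sum_{g\in Y_x}f(g.x)\,w(g)\,d\mu(x)$$ for Borel $f:Y\to[0,+\infty]$, where $w:G\to[0,+\infty]$ is any Borel function with $\int_G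 w\,dm_G=1$; it is $\sigma$-finite and does not depend on $w$. The intensity is $\iota_\mu(Y)=\mu_Y(Y)$. Intersection covolume: let $Y^{[2]}=\{(g.y_1,g.y_2): g\in G,\ y_1,y_2\in Y\}\subseteq X\times X$, a Borel $G$-space under the diagonal action, having $Y\times Y$ as a cross section. There is exactly one $G$-invariant $\sigma$-finite Borel measure $\mu^{[2]}$ on $Y^{[2]}$ whose transverse measure on $Y\times Y$ is $\mu_Y\otimes\mu_Y$. Set $I_\mu(Y)=\mu^{[2]}(Y^{[2]})\in(0,+\infty]$. A $G$-factor $\phi:(X,\mu)\to(W,\nu)$ of probability preserving $G$-spaces is a Borel map $\phi:X\to W$ with $\phi_*\mu=\nu$ and, for every $g\in G$, $\phi(g.x)=g.\phi(x)$ for $\mu$-a.e. $x$. A transverse $G$-factor $\phi:(X,\mu,Y)\to(W,\nu,Z)$ is a $G$-factor $\phi:(X,\mu)\to(W,\nu)$ with $Y_x=Z_{\phi(x)}$ for $\mu$-a.e. $x\in X$. For a lattice $\Gamma<G$ (discrete subgroup of finite covolume), $G$ acts on $\Gamma\backslash G$ by $g_0.\Gamma g=\Gamma g g_0^{-1}$, $m_{\Gamma\backslash G}$ is the unique $G$-invariant probability measure, and $\{\Gamma\}$ is the one-point cross section consisting of the identity coset. *)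

(* Defs.v *)
From HB Require Import structures.
From mathcomp Require Import all_boot all_order all_algebra.
From mathcomp Require Import all_classical all_reals all_analysis.
From mathcomp Require Import measurable_realfun.

Set Implicit Arguments.
Unset Strict Implicit.
Unset Printing Implicit Defensive.

Import Order.TTheory GRing.Theory Num.Theory.

Local Open Scope classical_set_scope.
Local Open Scope ring_scope.

HB.mixin Record PointedTopological_Group_isTopologicalGroup (G : Type)
    & Group G & PointedTopological G := {
  mulg_continuous : continuous (fun xy : G * G => xy.1 * xy.2)%g ;
  invg_continuous : continuous (fun x : G => x^-1)%g
}.

(* The distinguished point is arbitrary: measurable types are pointed in the
   library, and it is only there so that G can carry its Borel structure. *)
#[short(type="topologicalGroupType")]
HB.structure Definition TopologicalGroup :=
  { G of Group G & PointedTopological G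
       & PointedTopological_Group_isTopologicalGroup G }.

Notation borel T := (g_sigma_algebraType (@open T)).

Section StandardBorel.
Variable R : realType.

Definition complete_space (P : metricType R) :=
  forall F : set_system P, ProperFilter F -> cauchy F -> exists p : P, F --> p.

Definition separable_space (P : topologicalType) :=
  exists2 D : set P, countable D & dense D.

Definition standard_borel d (X : measurableType d) :=
  exists P : metricType R,
    [/\ complete_space P, separable_space P &
        exists2 f : X -> P, bijective f &
          forall A : set X, measurable A <-> <<s @open P >> (f @` A)].

End StandardBorel.

Section HaarMeasure.
Variables (R : realType) (G : topologicalGroupType).
Implicit Type m : {measure set (borel G) -> \bar R}.

Definition left_invariant m := forall (g : G) (A : set G),
  measurable (A : set (borel G)) -> m [set x | A (g * x)%g] = m A.

Definition right_invariant m := forall (g : G) (A : set G),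
  measurable (A : set (borel G)) -> m [set x | A (x * g)%g] = m A.

(* Regularity is not listed: G is locally compact and second countable, so
   every Borel measure finite on compact sets is regular. *)
Definition haar_measure m :=
  [/\ left_invariant m, m setT != 0%E &
      forall K : set G, compact K -> (m K < +oo)%E].

End HaarMeasure.

Section Actions.
Variables (G : topologicalGroupType) (d : measure_display).
Variable X : measurableType d.
Implicit Types (act : G -> X -> X) (Y : set X).

Definition is_action act :=
  (forall x, act 1%g x = x) /\
  (forall g h x, act (g * h)%g x = act g (act h x)).

Definition borel_G_space (R : realType) act :=
  [/\ standard_borel R X, is_action act &
      measurable_fun setT (fun gx : borel G * X => act gx.1 gx.2)].

Definition invariant_measure (R : realType) act
    (m : {measure set X -> \bar R}) :=
  forall (g : G) (A : set X), measurable A -> m (act g @^-1` A) = m A.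

Definition return_set act Y (x : X) : set G := [set g | Y (act g x)].

Definition saturation act Y : set X :=
  [set x | exists g y, Y y /\ x = act g y].

End Actions.

Definition diag_act (G X : Type) (act : G -> X -> X) (g : G) (x : X * X) :
  X * X := (act g x.1, act g x.2).

Definition locally_finite_set (T : topologicalType) (A : set T) :=
  forall K : set T, compact K -> finite_set (A `&` K).

Section TransverseMeasures.
Variables (R : realType) (G : topologicalGroupType).
Variable mG : {measure set (borel G) -> \bar R}.
Local Open Scope ereal_scope.

Definition locally_integrable_cross_section d (X : measurableType d)
    (act : G -> X -> X) (mu : {measure set X -> \bar R}) (Y : set X) :=
  [/\ measurable Y,
      mu.-negligible (~` saturation act Y),
      (forall x, saturation act Y x -> locally_finite_set (return_set act Y x))
    & (forall K : set G, compact K ->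
        \int[mu]_x counting (return_set act Y x `&` K) < +oo)].

(* tau is a measure on the Borel set Y, encoded as a measure on X carried by Y.
   It is characterised by the formula rather than defined by it: the right-hand
   side does not depend on the normalised weight w. *)
Definition transverse_measure d (X : measurableType d)
    (act : G -> X -> X) (m : {measure set X -> \bar R}) (Y : set X)
    (tau : {measure set X -> \bar R}) :=
  tau (~` Y) = 0 /\
  forall (w : borel G -> \bar R) (f : X -> \bar R),
    measurable_fun setT w -> (forall g, 0 <= w g) -> \int[mG]_g w g = 1 ->
    measurable_fun Y f -> (forall y, Y y -> 0 <= f y) ->
    \int[tau]_(y in Y) f y =
    \int[m]_x \esum_(g in return_set act Y x) (f (act g x) * w g).

Section Intersection.
Context d (X : measurableType d).
Variables (act : G -> X -> X) (Y : set X).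

Definition pair_saturation : set (X * X) :=
  saturation (diag_act act) (Y `*` Y).

(* mu2 is the measure mu^[2] on Y^[2] = pair_saturation, encoded as a measure on
   X * X carried by that set; muY is the transverse measure of mu. There is
   exactly one such mu2. *)
Definition intersection_measure (muY : {sigma_finite_measure set X -> \bar R})
    (mu2 : {sigma_finite_measure set (X * X)%type -> \bar R}) :=
  [/\ mu2.-negligible (~` pair_saturation),
      invariant_measure (diag_act act) mu2 &
      transverse_measure (diag_act act) mu2 (Y `*` Y) (muY \x muY)].

Definition intensity (muY : {sigma_finite_measure set X -> \bar R}) := muY Y.

(* mu2 is carried by pair_saturation, so its total mass is the mass of that
   set. *)
Definition intersection_covolume
  (mu2 : {sigma_finite_measure set (X * X)%type -> \bar R}) := mu2 setT.

End Intersection.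
End TransverseMeasures.

Section Factors.
Variables (R : realType) (G : topologicalGroupType).
Context d (X : measurableType d) d' (W : measurableType d').
Variables (actX : G -> X -> X) (mu : probability X R) (Y : set X).
Variables (actW : G -> W -> W) (nu : probability W R) (Z : set W).

Definition G_factor (phi : X -> W) :=
  [/\ measurable_fun setT phi,
      (forall B : set W, measurable B -> pushforward mu phi B = nu B) &
      (forall g : G, {ae mu, forall x, phi (actX g x) = actW g (phi x)})].

Definition transverse_G_factor (phi : X -> W) :=
  G_factor phi /\
  {ae mu, forall x, return_set actX Y x = return_set actW Z (phi x)}.

End Factors.

Section CosetSpace.
Variables (G : topologicalGroupType) (Gamma : groupClosed G).
Local Open Scope quotient_scope.

Definition coset_rel : rel G := fun x y => (x / y)%g \in Gamma.

Lemma coset_rel_equiv : equiv_class_of coset_rel.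
Proof.
split=> [x|x y|y x z]; rewrite /coset_rel.
- by rewrite divgg gpred1.
- exact: gpredFC.
- by move=> xy yz; rewrite -(mulgVK y x) -mulgA gpredM.
Qed.

Canonical coset_equiv := EquivRelPack coset_rel_equiv.

(* The space Gamma\G; the class of g is the coset Gamma g. *)
Definition coset_space := quotient_topology {eq_quot coset_equiv}.

HB.instance Definition _ := PointedTopological.on coset_space.

Definition coset_pi (g : G) : coset_space := \pi_{eq_quot coset_equiv} g.

(* g0.(Gamma g) = Gamma g g0^-1, computed on a representative *)
Definition coset_act (g0 : G) (q : borel coset_space) : borel coset_space :=
  coset_pi (repr (q : {eq_quot coset_equiv}) * g0^-1)%g.

Definition discrete_subgroup :=
  forall g : G, g \in Gamma ->
    exists2 U : set G, open_nbhs g U & U `&` [set h | h \in Gamma] = [set g].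

Definition lattice (R : realType) :=
  discrete_subgroup /\
  exists m : {measure set (borel coset_space) -> \bar R},
    [/\ invariant_measure coset_act m, m setT != 0%E & (m setT < +oo)%E].

End CosetSpace.

(* Main.v *)
Require Import Defs.
From HB Require Import structures.
From mathcomp Require Import all_boot all_order all_algebra.
From mathcomp Require Import finmap.
From mathcomp Require Import all_classical all_reals all_analysis.
From mathcomp Require Import measurable_realfun.

(** ** Why the inequality holds, and when it is an equality

    For x in X write Y_x for the set of g with g.x in Y. The transverse measure
    is characterised by the Campbell formula (lemma campbell_formula)
      int_X sum_(g in Y_x) F (g, g.x) dm (x) = int_(G x Y) F d(mG x tau),
    valid for every nonnegative Borel F once it is known for products; it
    applies both to (X, mu, Y, muY) and to the diagonal action on X x X, with
    the cross section Y x Y, the measure mu2 and the transverse measure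
    muY x muY. In the second case the return set of (x1, x2) is the
    intersection of Y_x1 and Y_x2.

    Choose w > 0 on G with finite integral and normalise it along each return
    set: q (x) = 1 / sum_(g in Y_x) w (g). The sum is finite and nonzero almost
    everywhere because muY is finite and the saturation of Y is conull. Let
      A (x1, x2) = q (x1) * sum of w over the intersection of Y_x1 and Y_x2.
    Then A <= 1. Since q (x1) * w (g), read at (g, g.x1, g.x2), does not depend
    on the second point, two applications of the Campbell formula give
      int A dmu2 = muY (Y) * int_X q (x) * sum_(g in Y_x) w (g) dmu = muY (Y).
    Hence muY (Y) <= mu2 (X x X) (theorem intensity_le_covolume).

    If equality holds, A = 1 almost everywhere, and as w > 0 this says that
    Y_x1 is contained in Y_x2 for mu2-almost every pair. The formula carries
    null sets back to Y x Y, and Fubini produces a single set L with Y_y = L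
    for muY-almost every y (theorem equality_return_ae_constant). Transferring
    once more, for almost every x and all g in Y_x, the set Y_(g.x) equals L,
    that is Y_x = L g. Comparing the representations for different g shows that
    L is a subgroup Gamma, so that x |-> Gamma g is an equivariant map to the
    coset space; it pushes mu to a finite invariant measure.

    Conversely, given a transverse factor onto the coset space, almost every
    Y_x is a coset of Gamma. Two cosets that meet are equal, and mu2 lives on
    pairs whose return sets meet; so A = 1 almost everywhere and equality holds
    (theorem equality_of_return_eq).

    ** Measurability

    None of the sums over Y_x is Borel for an obvious reason: whether Y_x meets
    an open set is a question about the projection of a Borel set. What
    settles it is that the projection to X of a Borel subset of G x X is
    measurable up to a null set, for every sigma-finite measure on X (lemma
    measurable_projection). The proof is Choquet's
    capacitability argument for Souslin sets built on rectangles of a closed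
    set and a measurable set. Counting along finer and finer finite
    partitions of G then makes all sums over return sets measurable up to null
    sets, which is enough because the integral of an arbitrary nonnegative
    function is a supremum over simple functions below it, and is unchanged by
    a modification on a null set (lemma ae_version_integral). *)

Set Implicit Arguments.
Unset Strict Implicit.
Unset Printing Implicit Defensive.

Import Order.TTheory GRing.Theory Num.Theory.
Local Open Scope classical_set_scope.
Local Open Scope ring_scope.

(** * Souslin sets over rectangles *)

Section Souslin.
Context (T : ptopologicalType) d (X : measurableType d).
Implicit Types A : set (borel T * X).

(** The Souslin operation applied to rectangles with a closed first factor. The
    two factors are indexed separately, and a branch s gives at stage n the
    condition attached to its first n values. *)
Definition souslin A := exists (H : seq nat -> set T) (F : seq nat -> set X),
  [/\ forall l, closed (H l), forall l, measurable (F l) &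
      forall p, A p <-> exists s : nat -> nat,
        forall n, H (mkseq s n) p.1 /\ F (mkseq s n) p.2].

Lemma souslin_closed_rect (H : set T) (F : set X) :
  closed H -> measurable F -> souslin (H `*` F).
Proof.
move=> cH mF; exists (fun=> H), (fun=> F); split=> // p; split=> [HFp|[s /(_ 0%N)//]].
by exists id.
Qed.

(** The first value of a branch selects the member of the union, the remaining
    ones are a branch for that member. *)
Lemma souslin_bigcup (A : nat -> set (borel T * X)) :
  (forall m, souslin (A m)) -> souslin (\bigcup_m A m).
Proof.
move=> /choice[H /choice[F AHF]].
exists (fun l => if l is m :: l' then H m l' else setT),
  (fun l => if l is m :: l' then F m l' else setT); split.
- by case=> [|m l]; [exact: closedT|case: (AHF m)].
- by case=> [|m l]; [exact: measurableT|case: (AHF m)].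
have mkS (s : nat -> nat) n : mkseq s n.+1 = s 0%N :: mkseq (s \o succn) n.
  by rewrite /mkseq/= -[1%N]addn0 iotaDl -map_comp.
move=> p; split=> [[m _ Amp]|[s sp]].
  have [_ _ /(_ p)[/(_ Amp)[s sp] _]] := AHF m.
  exists (fun n => if n is k.+1 then s k else m) => -[//|n].
  by rewrite mkS/= (_ : _ \o _ = s).
exists (s 0%N) => //; have [_ _ ->] := AHF (s 0%N).
by exists (s \o succn) => n; have := sp n.+1; rewrite mkS.
Qed.

(* The pair (m, i) is coded by 2 ^ m * (2 i + 1). What matters is that the code
   is increasing in i: the k-th condition on the m-th branch, posed at time
   code m k, then only reads values chosen at earlier times. *)
Let code m i := (2 ^ m * i.*2.+1)%N.
Let decode1 n := logn 2 n.
Let decode2 n := (n %/ 2 ^ logn 2 n)./2.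

Let codeK1 m i : decode1 (code m i) = m.
Proof.
rewrite /decode1 /code lognM ?expn_gt0// pfactorK// lognE/= dvdn2/= odd_double/=.
by rewrite addn0.
Qed.

Let codeK2 m i : decode2 (code m i) = i.
Proof.
have := codeK1 m i; rewrite /decode1 /decode2 => ->.
by rewrite /code mulKn ?expn_gt0//= uphalf_double.
Qed.

Let code_lt n i : (i < decode2 n)%N -> (code (decode1 n) i < n)%N.
Proof.
rewrite /decode2 /code /decode1; set d1 := (2 ^ _)%N => id2.
have d1_gt0 : (0 < d1)%N by rewrite expn_gt0.
rewrite mulnC -ltn_divRL// ?pfactor_dvdnn//; apply: leq_trans (_ : (n %/ d1)./2.*2 <= _)%N.
  by rewrite -doubleS leq_double.
by rewrite -[leqRHS]odd_double_half leq_addl.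
Qed.

(** One branch interlaces branches for all the members of the intersection. *)
Lemma souslin_bigcap (A : nat -> set (borel T * X)) :
  (forall m, souslin (A m)) -> souslin (\bigcap_m A m).
Proof.
move=> /choice[H /choice[F AHF]].
pose sub l m k := mkseq (fun i => nth 0%N l (code m i)) k.
exists (fun l => H (decode1 (size l)) (sub l (decode1 (size l)) (decode2 (size l)))),
  (fun l => F (decode1 (size l)) (sub l (decode1 (size l)) (decode2 (size l)))); split.
- by move=> l; case: (AHF (decode1 (size l))).
- by move=> l; case: (AHF (decode1 (size l))).
have subE s n : sub (mkseq s n) (decode1 n) (decode2 n) =
    mkseq (s \o code (decode1 n)) (decode2 n).
  apply/eq_in_map => i; rewrite mem_iota/= add0n => id2.
  by rewrite nth_mkseq//; exact: code_lt.
move=> p; split=> [Ap|[s sp] m _].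
  have /choice[s sp] : forall m, exists s : nat -> nat,
      forall n, H m (mkseq s n) p.1 /\ F m (mkseq s n) p.2.
    by move=> m; have [_ _ /(_ p)[]] := AHF m; move=> /(_ (Ap m I)).
  exists (fun n => s (decode1 n) (decode2 n)) => n; rewrite size_mkseq subE.
  rewrite (_ : _ \o _ = s (decode1 n))//; apply/funext => i /=.
  by rewrite codeK1 codeK2.
have [_ _ ->] := AHF m; exists (s \o code m) => k.
have := sp (code m k); rewrite size_mkseq subE codeK1 codeK2.
by [].
Qed.

Hypothesis open_Fsigma : forall U : set T, open U ->
  exists2 H : nat -> set T, (forall n, closed (H n)) & U = \bigcup_n H n.

(** The sets that are Souslin together with their complement form a
    sigma-algebra, and a rectangle with an open side is Souslin because the
    open side is a countable union of closed sets. *)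
Lemma souslin_measurable A : measurable A -> souslin A.
Proof.
suff: measurable `<=` [set A : set (borel T * X) | souslin A /\ souslin (~` A)].
  by move=> /[apply] -[].
have s0 : souslin set0.
  by rewrite -(set0X (setT : set X)); apply: souslin_closed_rect => //; exact: closed0.
have sT : souslin setT.
  by rewrite -setXTT; apply: souslin_closed_rect => //; exact: closedT.
set Q := [set A | _].
have QC B : Q B -> Q (~` B) by case=> sB sCB; split; rewrite ?setCK.
have QU (B : nat -> set (borel T * X)) : (forall n, Q (B n)) -> Q (\bigcup_n B n).
  move=> QB; split; first by apply: souslin_bigcup => n; case: (QB n).
  by rewrite setC_bigcup; apply: souslin_bigcap => n; case: (QB n).
have Qsigma : sigma_algebra setT Q.
  split=> [|B|//]; first by split; rewrite ?setC0.
  by rewrite setTD; exact: QC.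
rewrite measurable_prod_measurableType.
apply: smallest_sub => // _ [B mB [F mF <-]].
rewrite (_ : B `*` F = (B `*` setT) `&` (setT `*` F)); last first.
  by rewrite -setXI setIT setTI.
have QF : Q (setT `*` F).
  split; first by apply: souslin_closed_rect => //; exact: closedT.
  rewrite (_ : ~` _ = setT `*` (~` F)).
    by apply: souslin_closed_rect; [exact: closedT|exact: measurableC].
  by apply/seteqP; split=> -[x y]/=; [move=> h; split=> // Fy; apply: h|move=> [_ nF] []].
have QI C D : Q C -> Q D -> Q (C `&` D).
  move=> QC' QD; rewrite -[C `&` D]setCK setCI -bigcup2E.
  by apply/QC/QU => -[|[|n]]; rewrite /bigcup2/=; [exact: QC|exact: QC|split; rewrite ?setC0].
apply: QI => //.
have bigcup_setT_prod (C : nat -> set T) :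
    (\bigcup_n C n) `*` (setT : set X) = \bigcup_n (C n `*` setT).
  by apply/seteqP; split=> [[x y] [[n _ Cx] _]|[x y] [n _ [Cx _]]]; [exists n|split=> //; exists n].
suff: @measurable _ (borel T) `<=` [set B | Q (B `*` setT)] by exact.
apply: smallest_sub => [|U oU].
  split=> [|C|C QC'].
  - by rewrite /= set0X; split; rewrite ?setC0.
  - move=> QC'; rewrite /= setTD (_ : _ `*` _ = ~` (C `*` setT)); first exact: QC.
    by apply/seteqP; split=> -[x y]/=; [move=> [nC _] []|move=> h; split=> // Cx; apply: h].
  - by rewrite /= bigcup_setT_prod; exact: QU.
split.
  have [H cH ->] := open_Fsigma oU; rewrite bigcup_setT_prod.
  by apply: souslin_bigcup => n; exact: souslin_closed_rect.
rewrite (_ : ~` _ = (~` U) `*` setT); first by apply: souslin_closed_rect => //; exact: open_closedC.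
by apply/seteqP; split=> -[x y]/=; [move=> h; split=> // Cx; apply: h|move=> [nC _] []].
Qed.
End Souslin.

(** * Capacitability and measurable projection *)

Lemma seq_dependent_choice (P : seq nat -> Prop) :
  P [::] -> (forall l, P l -> exists m, P (rcons l m)) ->
  exists s : nat -> nat, forall n, P (mkseq s n).
Proof.
move=> P0 PS; have /choice[f Pf] l : exists m, P l -> P (rcons l m).
  by have [/PS[m ?]|?] := pselect (P l); [exists m|exists 0%N].
pose L n := iter n (fun l => rcons l (f l)) [::].
have LE n : mkseq (f \o L) n = L n by elim: n => // n IH; rewrite mkseqS IH.
by exists (f \o L); elim=> // n; rewrite mkseqS LE => /Pf.
Qed.

Lemma take_mkseq (s : nat -> nat) n k : (n <= k)%N -> take n (mkseq s k) = mkseq s n.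
Proof. by move=> nk; rewrite /mkseq -map_take take_iota (minn_idPl nk). Qed.

Section Capacity.
Context (R : realType) d (X : measurableType d) (mu : {measure set X -> \bar R}).
Local Open Scope ereal_scope.

(** The outer measure of E exceeds t. Stated through the measurable hulls of E,
    this passes to increasing unions without any outer measure being formed. *)
Definition thick t (E : set X) :=
  forall B, measurable B -> E `<=` B -> t < mu B.

Lemma thick_subset t (E E' : set X) : E `<=` E' -> thick t E -> thick t E'.
Proof. by move=> EE' tE B mB E'B; apply: tE => //; exact: subset_trans E'B. Qed.

(** Outer measures are continuous along increasing sequences: if each E n had a
    hull B n of measure at most t, the lower limit of the B n would be a hull
    of the union. *)
Lemma thick_bigcup t (E : nat -> set X) : nondecreasing_seq E ->
  thick t (\bigcup_n E n) -> exists n, thick t (E n).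
Proof.
move=> ndE tE; apply: contrapT => /forallNP nt.
have /choice[B /all_and3[mB EB Bt]] n : exists B,
    [/\ measurable B, E n `<=` B & mu B <= t].
  have /existsNP[B /not_implyP[mB /not_implyP[EB /negP]]] := nt n.
  by rewrite -leNgt => ?; exists B.
pose C n := \bigcap_(k in [set k | (n <= k)%N]) B k.
have mC n : measurable (C n) by apply: bigcap_measurable => //; exists n => /=.
have ndC : nondecreasing_seq C.
  apply/nondecreasing_seqP => n; apply/subsetPset => x Cx k /= nk.
  by apply: Cx => /=; exact: ltnW.
have mUC : measurable (\bigcup_n C n) by exact: bigcupT_measurable.
have /(_ _ mUC) : thick t (\bigcup_n C n).
  apply: thick_subset tE; apply: subset_bigcup => n _ x Ex k /= nk.
  by apply/EB; have /subsetPset := ndE _ _ nk; exact.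
move=> /(_ (@subset_refl _ _)); apply/negP; rewrite -leNgt.
have h := nondecreasing_cvg_mu (mu := mu) mC mUC ndC.
rewrite -(cvg_lim _ h)//; apply: lime_le; first by apply/cvg_ex; eexists; exact: h.
apply: nearW => n /=; apply: le_trans (Bt n); rewrite le_measure ?inE//.
by move=> x /(_ n); apply => /=.
Qed.

Hypothesis mu_fin : mu setT < +oo.

Lemma thick_bigcap t (E : nat -> set X) : (forall n, measurable (E n)) ->
  nonincreasing_seq E -> (forall n, t <= mu (E n)) -> t <= mu (\bigcap_n E n).
Proof.
move=> mE niE tE; have mIE : measurable (\bigcap_n E n) by exact: bigcapT_measurable.
have E0 : mu (E 0%N) < +oo by apply: le_lt_trans mu_fin; rewrite le_measure ?inE.
have h := nonincreasing_cvg_mu E0 mE mIE niE.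
rewrite -(cvg_lim _ h)//; apply: lime_ge; first by apply/cvg_ex; eexists; exact: h.
by apply: nearW => n /=.
Qed.

Context (T : ptopologicalType).

(** Choquet's theorem for the capacity that sends a set to the outer measure of
    its projection. The values of the branches can be bounded one after
    the other, by tau, so that the projection stays thick. The branches bounded
    by tau form a compact set: a point that survives every finite stage is in
    the projection, by a Koenig argument on branches followed by compactness of
    K along the branch found. *)
Lemma souslin_capacitable (A : set (borel T * X)) (K : set T) t : compact K -> souslin A ->
  thick t [set x | exists g, K g /\ A (g, x)] ->
  exists C, [/\ measurable C, C `<=` [set x | exists g, A (g, x)] & t <= mu C].
Proof.
move=> cK [H [F [cH mF AE]]] tA.
(* Points reached by a branch whose first values are bounded by those of l. *)
pose apx l := [set x | exists g s, [/\ K g,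
  forall i, (i < size l)%N -> (s i <= nth 0%N l i)%N &
  forall n, H (mkseq s n) g /\ F (mkseq s n) x]].
have [|l tl|tau ttau] := @seq_dependent_choice (fun l => thick t (apx l)).
- apply: thick_subset tA => x [g [Kg]] /AE[s HFs].
  by exists g, s; split.
- apply: thick_bigcup.
    apply/nondecreasing_seqP => m; apply/subsetPset => x [g [s [Kg sl HFs]]].
    exists g, s; split=> // i; rewrite size_rcons => il.
    apply: leq_trans (sl i _) _; first by rewrite size_rcons.
    by rewrite !nth_rcons; do 2 case: ifPn => //.
  apply: thick_subset tl => x [g [s [Kg sl HFs]]].
  exists (s (size l)) => //; exists g, s; split=> // i.
  rewrite size_rcons ltnS leq_eqVlt nth_rcons => /predU1P[->|il].
    by rewrite ltnn eqxx.
  by rewrite il; exact: sl.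
(* The n-th approximation only looks at the first n conditions, so it is a
   countable union of measurable sets. *)
pose box l := forall i, (i < size l)%N -> (nth 0%N l i <= tau i)%N.
pose ok x l := exists2 g, K g & forall n, (n <= size l)%N -> H (take n l) g /\ F (take n l) x.
pose E k := [set x | exists l, [/\ size l = k, box l & ok x l]].
have box_take n l : box l -> box (take n l).
  move=> bl i; rewrite size_take_min leq_min => /andP[n1 n2].
  by rewrite nth_take//; exact: bl.
have ok_take x n l : ok x l -> ok x (take n l).
  move=> [g Kg HF]; exists g => // j; rewrite size_take_min leq_min => /andP[n1 n2].
  by rewrite take_takel//; exact: HF.
have mE k : measurable (E k).
  pose D := [set l : seq nat | size l = k /\ box l /\
    exists2 g, K g & forall n, (n <= size l)%N -> H (take n l) g].
  rewrite (_ : E k = \bigcup_(l in D) \bigcap_(n in [set n | (n <= size l)%N]) F (take n l)).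
    rewrite bigcup_mkcond; apply: countable_bigcupT_measurable => // l.
    case: ifPn => // _.
    by apply: bigcap_measurable => //; exists 0%N => /=.
  apply/seteqP; split=> [x [l [sl bl [g Kg HF]]]|x [l [sl [bl [g Kg Hl]]] Fx]].
    exists l; first by do 2 split=> //; exists g => // n /HF[].
    by move=> n /= /HF[].
  by exists l; split=> //; exists g => // n nl; split; [exact: Hl|exact: Fx].
exists (\bigcap_k E k); split.
- exact: bigcapT_measurable.
- move=> x Ex.
  (* A node is alive when it has admissible extensions of every length; it has
     finitely many children within the bounds tau, one of which is alive. *)
  pose alive l := forall k, (size l <= k)%N ->
    exists l', [/\ size l' = k, take (size l) l' = l, box l' & ok x l'].
  have [k _|l al|s sal] := @seq_dependent_choice alive.
  + by have [l [sl bl okl]] := Ex k I; exists l; split; rewrite ?take0.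
  + apply: contrapT => /forallNP nal.
    have /choice[K' K'P] m : exists k, (size l < k)%N /\ forall l', ~ [/\ size l' = k,
        take (size l).+1 l' = rcons l m, box l' & ok x l'].
      have /existsNP[k /not_implyP[]] := nal m.
      by rewrite size_rcons => lk /forallNP h; exists k.
    (* If every child dies at some stage, so does the node. *)
    pose M := maxn (size l).+1 (\max_(m < (tau (size l)).+1) K' m)%N.
    have lM : (size l < M)%N by rewrite leq_max leqnn.
    have [l' [sl' tl' bl' okl']] := al M (ltnW lM).
    have lm : (nth 0%N l' (size l) < (tau (size l)).+1)%N by rewrite ltnS bl'// sl'.
    have [lK' /(_ (take (K' (nth 0%N l' (size l))) l'))] := K'P (nth 0%N l' (size l)).
    apply; split; [|  |exact: box_take|exact: ok_take].
    * rewrite size_takel// sl' leq_max; apply/orP; right.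
      exact: (leq_bigmax (F := fun i : 'I__ => K' i) (Ordinal lm)).
    * by rewrite take_takel// (take_nth 0%N) ?sl'// tl'.
  have {}sal k : exists2 g, K g & forall n, (n <= k)%N -> H (mkseq s n) g /\ F (mkseq s n) x.
    have := sal k k; rewrite size_mkseq leqnn => /(_ isT)[l' [sl' tl' _ [g Kg HF]]].
    exists g => // n nk; have := HF n; rewrite sl' nk => /(_ isT).
    by rewrite -{1 2}(take_size l') sl' tl' take_mkseq.
  have := cK; rewrite compact_In0.
  move=> /(_ nat setT (fun n => K `&` H (mkseq s n))) [||g Hg].
  + by exists (fun n => H (mkseq s n)).
  + move=> D _; have [g Kg Hg] := sal (\max_(i <- enum_fset D) i)%N.
    exists g => i /= iD; split=> //; apply: (proj1 (Hg i _)).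
    exact: (leq_bigmax_seq (F := id)).
  exists g; apply/AE; exists s => n; split; first by have [] := Hg n I.
  by have [g' _ /(_ n (leqnn n))[]] := sal n.
- apply: thick_bigcap => //.
    apply/nonincreasing_seqP => k; apply/subsetPset => x [l [sl bl okl]].
    by exists (take k l); split; [rewrite size_takel// sl|exact: box_take|exact: ok_take].
  move=> k; apply/ltW/(ttau k) => // x [g [s [Kg sl HFs]]].
  exists (mkseq s k); split; first by rewrite size_mkseq.
    move=> i; rewrite size_mkseq => ik; rewrite nth_mkseq//.
    by have := sl i; rewrite size_mkseq nth_mkseq//; exact.
  exists g => // n; rewrite size_mkseq => nk.
  by rewrite take_mkseq//; exact: HFs.
Qed.
End Capacity.

(** A countable base adapted to a locally compact space. The last clause is
    regularity: neighbourhoods contain the closure of a member of the base. *)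
Definition precompact_base (T : topologicalType) (V : nat -> set T) :=
  [/\ forall i, open (V i), forall i, compact (closure (V i)) &
      forall x U, nbhs x U -> exists i, V i x /\ closure (V i) `<=` U].

Lemma precompact_base_exists (T : topologicalType) : hausdorff_space T ->
  locally_compact [set: T] -> @second_countable T ->
  exists V : nat -> set T, precompact_base V.
Proof.
move=> hT lT [B cB [Bo Bb]].
have [f fB] : exists f : nat -> set T, B `<=` range f.
  have /countable_injP[h hB] := cB.
  have /choice[f fE] i : exists C, forall U, B U -> h U = i -> C = U.
    have [[U [BU <-]]|nU] := pselect (exists U, B U /\ h U = i).
      by exists U => U' BU' /hB; rewrite !inE => /(_ BU' BU) ->.
    by exists setT => U BU hU; exfalso; apply: nU; exists U.
  by exists f => U BU; exists (h U) => //; exact: fE.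
pose ok i := B (f i) /\ compact (closure (f i)).
exists (fun i => if pselect (ok i) then f i else set0); split.
- by move=> i; case: pselect => h /=; [exact: Bo h.1|exact: open0].
- by move=> i; case: pselect => h /=; [exact: h.2|rewrite closure0; exact: compact0].
move=> x U xU; have [|W xW [cW clW]] := lT x; first by [].
have xW' : nbhs x W.
  by have := xW; rewrite /= withinET.
have [C xC CU] := compact_regular hT cW xW' (filterI xW' xU).
have [D [BD Dx] DC] := Bb x C xC.
have [i _ fi] := fB _ BD.
have clD : closure D `<=` W `&` U.
  by apply: subset_trans CU; exact: closureS.
exists i; case: pselect => [_|nok] /=; rewrite ?fi.
  by split=> //; apply: subset_trans clD _ => ? [].
exfalso; apply: nok; rewrite /ok fi; split=> //.
apply: (subclosed_compact _ cW); first exact: closed_closure.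
by move=> y /clD[].
Qed.

Section Base.
Context (T : ptopologicalType) (V : nat -> set T) (V_base : precompact_base V).

Lemma base_open (U : set T) : open U -> U = \bigcup_(i in [set i | closure (V i) `<=` U]) V i.
Proof.
move=> oU; apply/seteqP; split=> [x Ux|x [i iU Vx]]; last first.
  exact/iU/subset_closure.
have [_ _ /(_ x U)[|i [Vx VU]]] := V_base; first exact: open_nbhs_nbhs.
by exists i.
Qed.

Lemma base_open_Fsigma (U : set T) : open U ->
  exists2 H : nat -> set T, (forall n, closed (H n)) & U = \bigcup_n H n.
Proof.
move=> oU; exists (fun i => if pselect (closure (V i) `<=` U) then closure (V i) else set0).
  by move=> i; case: pselect => h /=; [exact: closed_closure|exact: closed0].
apply/seteqP; split=> [x|x [i _]]; last by case: pselect => h //=; exact: h.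
rewrite {1}(base_open oU) => -[i iU Vx]; exists i => //.
by case: pselect => h //=; exact: subset_closure.
Qed.

Lemma base_cover x : exists i, V i x.
Proof.
have [_ _ /(_ x setT)[|i [Vx _]]] := V_base; first exact: filterT.
by exists i.
Qed.

(** An exhaustion by compact sets, to which capacitability is applied. *)
Definition base_compacts n := \big[setU/set0]_(i < n) closure (V i).

Lemma base_compacts_compact n : compact (base_compacts n).
Proof. by apply: bigsetU_compact => i _; case: V_base. Qed.

Lemma base_compacts_nd : nondecreasing_seq base_compacts.
Proof. by move=> m n mn; apply/subsetPset; exact: (@subset_bigsetU _ (fun i => closure (V i)) m n mn). Qed.

Lemma base_compacts_cover x : exists n, base_compacts n x.
Proof.
have [i Vx] := base_cover x; exists i.+1.
by rewrite /base_compacts big_ord_recr/=; right; exact: subset_closure.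
Qed.

Context d (X : measurableType d) (R : realType).
Local Open Scope ereal_scope.

(** Membership in the completion of the sigma-algebra, spelt out with a
    measurable set and a measurable null set outside which they agree. *)
Definition ess_measurable_set (mu : {measure set X -> \bar R}) (E : set X) :=
  exists B N, [/\ measurable B, measurable N, mu N = 0 &
    forall x, ~ N x -> (E x <-> B x)].

(** The outer measure of the projection P is the supremum of the measures of
    the measurable subsets of P: a larger outer measure would be witnessed on
    one of the compact sets exhausting G, and capacitability would give a
    measurable subset beyond the supremum. *)
Lemma measurable_projection_fin (mu : {measure set X -> \bar R}) (E : set (borel T * X)) :
  mu setT < +oo -> measurable E -> ess_measurable_set mu [set x | exists g, E (g, x)].
Proof.
move=> muT mE; have sE := souslin_measurable base_open_Fsigma mE.
set P := [set x | _].
pose S := [set mu C | C in [set C | measurable C /\ C `<=` P]].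
have S0 : 0 <= ereal_sup S.
  apply: ereal_sup_ubound; exists set0; last exact: measure0.
  by split; [exact: measurable0|exact: sub0set].
have Sfin : ereal_sup S \is a fin_num.
  rewrite ge0_fin_numE//; apply: le_lt_trans muT; apply: ge_ereal_sup => _ [C [mC _] <-].
  by rewrite le_measure ?inE.
have outer (e : R) : (0 < e)%R -> exists B, [/\ measurable B, P `<=` B & mu B <= ereal_sup S + e%:E].
  move=> e0; apply: contrapT => /forallNP nB.
  have tP : thick mu (ereal_sup S + e%:E) P.
    move=> B mB PB; rewrite ltNge; apply/negP => muB; exact: (nB B).
  have [n tn] : exists n, thick mu (ereal_sup S + e%:E)
      [set x | exists g, base_compacts n g /\ E (g, x)].
    apply: thick_bigcup.
      move=> m n mn; apply/subsetPset => x [g [Kg Eg]]; exists g; split=> //.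
      by have /subsetPset := base_compacts_nd mn; exact.
    apply: thick_subset tP => x [g Eg].
    by have [n Kn] := base_compacts_cover g; exists n => //; exists g.
  have [C [mC CP]] := souslin_capacitable muT (@base_compacts_compact n) sE tn.
  apply/negP; rewrite -ltNge; apply: (@le_lt_trans _ _ (ereal_sup S)).
    by apply: ereal_sup_ubound; exists C.
  by rewrite lteDl.
have inner (e : R) : (0 < e)%R -> exists C, [/\ measurable C, C `<=` P & ereal_sup S - e%:E < mu C].
  move=> e0; have [_ [C [mC CP] <-] h] := ub_ereal_sup_adherent e0 Sfin.
  by exists C.
have e0 n : (0 < n.+1%:R^-1 :> R)%R by rewrite invr_gt0.
have /choice[B /all_and3[mB PB muB]] n := outer _ (e0 n).
have /choice[C /all_and3[mC CP muC]] n := inner _ (e0 n).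
have mIB : measurable (\bigcap_n B n) by exact: bigcapT_measurable.
have mUC : measurable (\bigcup_n C n) by exact: bigcupT_measurable.
exists (\bigcup_n C n), ((\bigcap_n B n) `\` \bigcup_n C n); split=> //.
- exact: measurableD.
- apply/eqP; rewrite eq_le measure_ge0 andbT; apply/lee_addgt0Pr => e e_gt0.
  have [n] : exists n, (n.+1%:R^-1 < e / 2)%R.
    have e20 : (0 < e / 2)%R by rewrite divr_gt0.
    have /cvgrPdist_lt/(_ _ e20)[n _] := @cvg_harmonic R.
    move=> /(_ n (leqnn n)); rewrite sub0r normrN /harmonic/= ger0_norm ?invr_ge0//.
    by exists n.
  move=> ne; rewrite add0e.
  have : mu ((\bigcap_n0 B n0) `\` \bigcup_n0 C n0) <= mu (B n `\` C n).
    rewrite le_measure ?inE//; [exact: measurableD|exact: measurableD|].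
    move=> x [Bx nCx]; split; first exact: Bx.
    by move=> Cx; apply: nCx; exists n.
  move=> /le_trans; apply.
  have CB : C n `<=` B n by apply: subset_trans (PB n); exact: CP.
  have muCfin : mu (C n) \is a fin_num.
    by rewrite ge0_fin_numE//; apply: le_lt_trans muT; rewrite le_measure ?inE.
  rewrite measureD//; last by apply: le_lt_trans muT; rewrite le_measure ?inE.
  rewrite setIidr// leeBlDr//.
  have hC : ereal_sup S <= mu (C n) + (e / 2)%:E.
    rewrite -leeBlDr//; apply: le_trans (ltW (muC n)).
    by rewrite leeD2l// leeN2 lee_fin ltW.
  apply: le_trans (muB n) _; apply: le_trans (leeD2r _ hC) _.
  by rewrite -addeA addeC leeD2r// -EFinD lee_fin [leRHS]splitr lerD2l ltW.
- move=> x nN; split=> [Px|[n _ /CP]//]; apply: contrapT => nC; apply: nN.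
  by split=> // n _; exact: PB.
Qed.

(** The sigma-finite case, by restriction to pieces of finite measure. *)
Lemma measurable_projection (mu : {sigma_finite_measure set X -> \bar R}) (E : set (borel T * X)) :
  measurable E -> ess_measurable_set mu [set x | exists g, E (g, x)].
Proof.
move=> mE; have [F FT /all_and2[mF muF]] := sigma_finiteT mu.
have /choice[B /choice[N BN]] n : ess_measurable_set (mrestr mu (mF n)) [set x | exists g, E (g, x)].
  apply: measurable_projection_fin => //.
  by rewrite /= /mrestr/= setTI; exact: muF.
exists (\bigcup_n (B n `&` F n)), (\bigcup_n (N n `&` F n)); split.
- by apply: bigcupT_measurable => n; apply: measurableI => //; case: (BN n).
- by apply: bigcupT_measurable => n; apply: measurableI => //; case: (BN n).
- apply/eqP; rewrite eq_le measure_ge0 andbT.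
  apply: (@le_trans _ _ (\sum_(n <oo) mu (N n `&` F n))).
    apply: measure_sigma_subadditive => //.
    - by move=> n; apply: measurableI => //; case: (BN n).
    - by apply: bigcupT_measurable => n; apply: measurableI => //; case: (BN n).
  by rewrite eseries0// => n _ _; case: (BN n).
- move=> x nN; have BE n : F n x -> ([set x | exists g, E (g, x)] x <-> B n x).
    by move=> Fx; have [_ _ _] := BN n; apply => Nx; apply: nN; exists n.
  split=> [Ex|[n _ [Bx Fx]]]; last exact/(BE _ Fx).
  have [n _ Fx] : (\bigcup_n F n) x by rewrite -FT.
  by exists n => //; split=> //; exact/(BE _ Fx).
Qed.

End Base.

(** * Functions measurable up to a null set *)

Import HBNNSimple.

Section AeMeasurable.
Context d (X : measurableType d) (R : realType) (mu : {measure set X -> \bar R}).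
Local Open Scope ereal_scope.
Implicit Types f : X -> \bar R.

Definition ae_version f f' := [/\ measurable_fun setT f', forall x, 0 <= f' x &
  {ae mu, forall x, f x = f' x}].

Definition ess_measurable f := exists f', ae_version f f'.

(** The integral of a nonnegative function is a supremum over the simple
    functions below it, even without measurability; cutting a simple function
    off on a null set does not change its integral. *)
Lemma ae_version_integral f f' : (forall x, 0 <= f x) -> ae_version f f' ->
  \int[mu]_x f x = \int[mu]_x f' x.
Proof.
move=> f0 [mf' f'0 [N [mN muN Nf]]]; apply/eqP; rewrite eq_le; apply/andP; split.
  rewrite ge0_integralTE//; apply: ge_ereal_sup => _ [h /= hf <-].
  rewrite -integralT_nnsfun; apply: ae_ge0_le_integral => //.
  - by move=> x _; rewrite lee_fin; exact: fun_ge0.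
  - by apply/measurable_EFinP; exact: measurable_funP.
  - exists N; split=> // x; apply: contra_notP => Nx _.
    apply: le_trans (hf x) _.
    suff -> : f x = f' x by [].
    by apply: contrapT => ff'; exact/Nx/Nf.
have mN' : measurable (~` N) by exact: measurableC.
rewrite (_ : \int[mu]_x f' x = \int[mu]_x (f' \_ (~` N)) x); last first.
  apply: ge0_ae_eq_integral => //.
  - by apply/(measurable_restrictT _ mN'); exact: measurable_funTS.
  - by move=> x _; rewrite patchE; case: ifPn.
  - exists N; split=> // x /= h; apply: contrapT => Nx; apply: h => _.
    by rewrite patchE mem_set.
rewrite !ge0_integralTE//; last by move=> x; rewrite patchE; case: ifPn.
apply: ereal_sup_le => _ [h /= hf <-]; exists h => // x.
apply: le_trans (hf x) _; rewrite patchE; case: ifPn => // /set_mem Nx.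
suff -> : f x = f' x by [].
by apply: contrapT => ff'; exact/Nx/Nf.
Qed.

Lemma measurable_ae_version f : measurable_fun setT f -> (forall x, 0 <= f x) ->
  ae_version f f.
Proof. by move=> mf f0; split=> //; exact: aeW. Qed.

Lemma ae_version_nneseries (f f' : nat -> X -> \bar R) : (forall n : nat, ae_version (f n) (f' n)) ->
  ae_version (fun x => \sum_(n <oo) f n x) (fun x => \sum_(n <oo) f' n x).
Proof.
move=> /all_and3[mf f0 aef]; split.
- by apply: ge0_emeasurable_sum => // n x _ _.
- by move=> x; exact: nneseries_ge0.
- have := ae_foralln aef; apply: filterS => x fx.
  by apply: eq_eseriesr => n _.
Qed.

Lemma ae_version_sum (I : Type) (s : seq I) (f f' : I -> X -> \bar R) : (forall i : I, ae_version (f i) (f' i)) ->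
  ae_version (fun x => \sum_(i <- s) f i x) (fun x => \sum_(i <- s) f' i x).
Proof.
move=> ff'; split.
- by apply: emeasurable_sum => i; case: (ff' i).
- by move=> x; apply: sume_ge0 => i _; case: (ff' i).
- elim: s => [|i s IH]; first by apply: aeW => x; rewrite !big_nil.
  have [_ _] := ff' i; apply: filterS2 IH => x h1 h2.
  by rewrite !big_cons h1 h2.
Qed.

Lemma ae_version_sup (f f' : nat -> X -> \bar R) : (forall n : nat, ae_version (f n) (f' n)) ->
  ae_version (fun x => ereal_sup (range (f ^~ x))) (fun x => ereal_sup (range (f' ^~ x))).
Proof.
move=> /all_and3[mf f0 aef]; split.
- have := measurable_fun_esups mf 0%N; apply: eq_measurable_fun => x _.
  by rewrite /esups /sdrop; congr ereal_sup; apply/seteqP; split=> _ [n _ <-]; exists n.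
- move=> x; apply: le_trans (f0 0%N x) _; apply: ereal_sup_ubound.
  by exists 0%N.
- have := ae_foralln aef; apply: filterS => x fx.
  by rewrite (_ : f ^~ x = f' ^~ x)//; apply/funext => n; exact: fx.
Qed.

Lemma ae_version_mul f f' g g' : ae_version f f' -> ae_version g g' ->
  ae_version (f \* g) (f' \* g').
Proof.
move=> [mf f0 aef] [mg g0 aeg]; split.
- exact: emeasurable_funM.
- by move=> x; exact: mule_ge0.
- by apply: filterS2 aef aeg => x /= -> ->.
Qed.

Lemma ess_measurable_nneseries (f : nat -> X -> \bar R) : (forall n : nat, ess_measurable (f n)) ->
  ess_measurable (fun x => \sum_(n <oo) f n x).
Proof.
by move=> /choice[f' ff']; eexists; exact: ae_version_nneseries ff'.
Qed.

Lemma ess_measurable_indic (E : set X) : ess_measurable_set mu E ->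
  ess_measurable (fun x => (\1_E x)%:E).
Proof.
move=> [B [N [mB mN muN EB]]]; exists (fun x => (\1_B x)%:E); split.
- exact/measurable_EFinP.
- by move=> x; rewrite lee_fin.
- exists N; split=> // x; apply: contra_notP => /EB EBx.
  rewrite /= !indicE; congr (_%:R%:E); congr nat_of_bool.
  by apply/idP/idP; rewrite !inE => /EBx.
Qed.

Lemma integral_ess_nneseries (f : nat -> X -> \bar R) :
  (forall n x, 0 <= f n x) -> (forall n : nat, ess_measurable (f n)) ->
  \int[mu]_x (\sum_(n <oo) f n x) = \sum_(n <oo) \int[mu]_x f n x.
Proof.
move=> f0 /choice[f' ff'].
rewrite (ae_version_integral _ (ae_version_nneseries ff')); last first.
  by move=> x; exact: nneseries_ge0.
rewrite integral_nneseries//; last 2 first.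
- by move=> n; case: (ff' n).
- by move=> n x _; case: (ff' n).
by apply: eq_eseriesr => n _; rewrite (ae_version_integral _ (ff' n)).
Qed.

Lemma integral_ess_scale (f : X -> \bar R) (k : \bar R) :
  0 <= k -> (forall x, 0 <= f x) -> ess_measurable f ->
  ess_measurable (fun x => k * f x) /\ \int[mu]_x (k * f x) = k * \int[mu]_x f x.
Proof.
move=> k0 f0 [f' ff'].
have kf : ae_version (fun x => k * f x) (fun x => k * f' x).
  by apply: ae_version_mul ff'; exact: measurable_ae_version.
split; first by eexists; exact: kf.
rewrite (ae_version_integral _ kf)//; last by move=> x; exact: mule_ge0.
by case: (ff') => mf' f'0 _; rewrite ge0_integralZl// -(ae_version_integral _ ff').
Qed.

End AeMeasurable.

(** * Counting the points of a section *)

Section EsumLemmas.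
Context (R : realType).
Local Open Scope ereal_scope.

Lemma esum_subset (I : choiceType) (A B : set I) (a : I -> \bar R) :
  A `<=` B -> \esum_(i in A) a i <= \esum_(i in B) a i.
Proof.
move=> AB; apply: ereal_sup_le => _ [F [fF FA] <-]; exists F => //.
by split=> //; exact: subset_trans AB.
Qed.

Lemma esum_nneseries (I : choiceType) (A : set I) (a : I -> nat -> \bar R) :
  (forall i n, 0 <= a i n) ->
  \esum_(i in A) \sum_(n <oo) a i n = \sum_(n <oo) \esum_(i in A) a i n.
Proof.
move=> a0; rewrite nneseries_esumT; last by move=> n; exact: esum_ge0.
under eq_esum do rewrite nneseries_esumT//.
rewrite !esum_esum//.
rewrite (reindex_esum (A `*`` (fun=> setT)) (setT `*`` (fun=> A)) (fun p => (p.2, p.1)))//.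
split=> [[i n] [/= Ai _]|[i n] [j m] _ _ [-> ->]//|[n i] [/= _ Ai]].
- by split.
- by exists (i, n).
Qed.

Lemma esumZl (I : choiceType) (A : set I) (a : I -> \bar R) (k : R) :
  (0 <= k)%R -> (forall i, 0 <= a i) ->
  \esum_(i in A) (k%:E * a i) = k%:E * \esum_(i in A) a i.
Proof.
move=> k0 a0; rewrite /esum -ereal_supZl//; last first.
  by apply/set0P; exists (\sum_(i \in set0) a i); exists set0 => //; exact: fsets_set0.
rewrite image_comp; congr ereal_sup; apply/eq_imagel => F [fF _] /=.
by rewrite !fsbig_finite//= ge0_sume_distrr.
Qed.

Lemma esum_eq0P (I : choiceType) (A : set I) (a : I -> \bar R) :
  (forall i, 0 <= a i) -> \esum_(i in A) a i = 0 -> forall i, A i -> a i = 0.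
Proof.
move=> a0 s0 i Ai; apply/eqP; rewrite eq_le a0 andbT -s0.
by rewrite -[leLHS]esum_set1//; apply: esum_subset => _ ->.
Qed.
End EsumLemmas.

Section Count.
Context (T : ptopologicalType) (V : nat -> set T) (V_base : precompact_base V).
Hypothesis T_hausdorff : hausdorff_space T.
Context (R : realType).
Local Open Scope ereal_scope.

(** The atoms of the partition of the space generated by the first n members
    of the base. *)
Definition itinerary n (g : T) : {ffun 'I_n -> bool} := [ffun i : 'I_n => `[< V i g >]].

Lemma measurable_itinerary n b : measurable ([set g | itinerary n g = b] : set (borel T)).
Proof.
rewrite (_ : [set _ | _] = \bigcap_(i in [set: 'I_n]) [set g | `[< V i g >] = b i]).
  apply: fin_bigcap_measurable => // i _.
  have mV : measurable (V i : set (borel T)).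
    by apply: sub_sigma_algebra; case: V_base.
  case: (b i); first by rewrite (_ : [set _ | _] = V i)//; apply/seteqP; split=> g /= /asboolP.
  rewrite (_ : [set _ | _] = ~` V i); first exact: measurableC.
  by apply/seteqP; split=> g /= => [/negbT/asboolPn//|nV]; apply/negbTE/asboolPn.
apply/seteqP; split=> [g /= <- i _ /=|g Vg]; first by rewrite ffunE.
by apply/ffunP => i; rewrite ffunE; exact: Vg.
Qed.

(** Each pair of points is separated by some member of the base, and finitely
    many pairs are separated at a common stage. *)
Lemma itinerary_separates (A : set T) : finite_set A ->
  exists n, set_inj A (itinerary n).
Proof.
move=> fA.
have /choice[sep sepP] (p : T * T) : exists i, p.1 <> p.2 -> V i p.1 /\ ~ V i p.2.
  have [<-|/eqP p12] := pselect (p.1 = p.2); first by exists 0%N.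
  have := T_hausdorff; rewrite open_hausdorff => /(_ _ _ p12)[[U W]/=].
  rewrite !inE => -[U1 W2] [oU oW UW0].
  have [_ _ /(_ p.1 U)[|i [Vi ViU]]] := V_base; first exact: open_nbhs_nbhs.
  exists i => _; split=> // Vi2.
  suff : (U `&` W) p.2 by rewrite UW0.
  by split=> //; exact/ViU/subset_closure.
have fB : finite_set (sep @` (A `*` A)) by apply/finite_image/finite_setX.
exists (\max_(i <- fset_set (sep @` (A `*` A))) i).+1 => g h /set_mem Ag /set_mem Ah gh.
apply: contrapT => ngh; have [Vg nVh] := sepP (g, h) ngh.
have lt_sep : (sep (g, h) < (\max_(i <- fset_set (sep @` (A `*` A))) i).+1)%N.
  rewrite ltnS; apply: (leq_bigmax_seq (F := id)) => //.
  by rewrite in_fset_set// inE; exists (g, h).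
move/ffunP/(_ (Ordinal lt_sep)): gh; rewrite !ffunE/= => ghV.
by apply: nVh; apply/asboolP; rewrite -ghV; exact/asboolP.
Qed.

(** The number of points of any set is the limit of the number of atoms that it
    meets. This reduces counting to the question whether a set meets an atom,
    which is a projection. *)
Lemma esum1_itinerary (S : set T) :
  \esum_(g in S) (1 : \bar R) =
  ereal_sup (range (fun n => \sum_(b : {ffun 'I_n -> bool})
     (\1_[set b | exists2 g, S g & itinerary n g = b] b)%:E)%E).
Proof.
have sumE n : \sum_(b : {ffun 'I_n -> bool})
     (\1_[set b | exists2 g, S g & itinerary n g = b] b)%:E =
     \esum_(b in itinerary n @` S) (1 : \bar R).
  rewrite esum_mkcond esum_fset; [|exact: finite_finset|by move=> b _; case: ifPn].
  rewrite fsbig_seq ?index_enum_uniq//.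
  rewrite (_ : [set` _] = setT); last first.
    by apply/seteqP; split=> // b _; rewrite /= mem_index_enum.
  by apply: eq_fsbigr => b _; rewrite indicE; case: (b \in _).
apply/eqP; rewrite eq_le; apply/andP; split.
  apply: ge_ereal_sup => _ [A [fA AS] <-].
  have [n injn] := itinerary_separates fA.
  apply: le_ereal_sup_tmp; exists (\esum_(b in itinerary n @` S) (1 : \bar R)).
    by exists n => //; rewrite sumE.
  rewrite -esum_fset// -(esum_image A (itinerary n) (fun=> 1))//.
  by apply: esum_subset; exact: image_subset.
apply: ge_ereal_sup => _ [n _ <-]; rewrite sumE.
have /choice[r rP] (b : {ffun 'I_n -> bool}) : exists g,
    (itinerary n @` S) b -> S g /\ itinerary n g = b.
  have [[g Sg gb]|nb] := pselect ((itinerary n @` S) b); first by exists g.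
  by exists point.
rewrite -(esum_image (itinerary n @` S) r (fun=> 1)).
  by apply: esum_subset => _ [b Sb <-]; have [] := rP b Sb.
move=> b c /set_mem Sb /set_mem Sc rbc.
by have [_ <-] := rP _ Sb; have [_ <-] := rP _ Sc; rewrite rbc.
Qed.

Lemma ess_measurable_section_count d (X : measurableType d)
    (mu : {sigma_finite_measure set X -> \bar R}) (E : set (borel T * X)) :
  measurable E -> ess_measurable mu (fun x => \esum_(g in [set g | E (g, x)]) 1).
Proof.
move=> mE; under eq_fun do rewrite esum1_itinerary.
pose hit n b := [set x | exists g, (E `&` ([set g | itinerary n g = b] `*` setT)) (g, x)].
have hitP n b : ess_measurable mu (fun x => (\1_(hit n b) x)%:E).
  apply/ess_measurable_indic/(measurable_projection V_base).
  apply: measurableI => //; apply: measurableX => //; exact: measurable_itinerary.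
have fP n b := projT2 (cid (hitP n b)).
eexists; apply: ae_version_sup => n.
have := ae_version_sum (index_enum {ffun 'I_n -> bool}) (fP n).
set h := (fun x => \sum_(i <- _) _) => vh.
rewrite (_ : (fun x => _) = h); first exact: vh.
apply/funext => x; apply: eq_bigr => b _; rewrite !indicE; congr (_%:R%:E).
congr nat_of_bool; apply/idP/idP; rewrite !inE => -[g].
  by move=> Eg bg; exists g; split.
by move=> [Eg [bg _]]; exists g.
Qed.

End Count.

(** * Expansion of a nonnegative function in indicators *)

Section HarmonicExpansion.
Context d (T : measurableType d) (R : realType) (F : T -> \bar R).
Hypothesis mF : measurable_fun setT F.
Hypothesis F0 : forall p, (0 <= F p)%E.

(** The greedy choice: the term 1 / (k + 1) is added whenever the result stays
    below F. *)
Fixpoint greedy n (p : T) : R := if n is k.+1 then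
  greedy k p + k.+1%:R^-1 * \1_[set q | ((greedy k q + k.+1%:R^-1)%:E <= F q)%E] p else 0.

Definition greedy_set n : set T := [set q | ((greedy n q + n.+1%:R^-1)%:E <= F q)%E].

Let measurable_greedy n : measurable_fun setT (greedy n) /\ measurable (greedy_set n).
Proof.
have step k : measurable_fun setT (greedy k) -> measurable (greedy_set k).
  move=> mg; rewrite -[greedy_set k]setTI; apply: measurable_lee => //.
  by apply/measurable_EFinP; exact: measurable_funD.
suff mg k : measurable_fun setT (greedy k) by split=> //; exact: step.
elim: k => [|k IH]; first exact: measurable_cst.
apply: measurable_funD => //; apply: measurable_funM => //.
by apply: measurable_indic; exact: step.
Qed.

Lemma measurable_greedy_set n : measurable (greedy_set n).
Proof. by case: (measurable_greedy n). Qed.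

Let greedy_le n p : ((greedy n p)%:E <= F p)%E.
Proof.
elim: n => [|n IH]; first exact: F0.
rewrite /= indicE; case: (boolP (p \in _)); last by rewrite mulr0 addr0.
by rewrite inE mulr1.
Qed.

Let greedyE n p : greedy n p = \sum_(0 <= k < n) k.+1%:R^-1 * \1_(greedy_set k) p.
Proof. by elim: n => [|n IH]; [rewrite big_nil|rewrite big_nat_recr//= -IH]. Qed.

(** If the sum stayed below F p by some positive amount, every term smaller than
    this amount would be added, and the harmonic series diverges. A fixed
    sequence of coefficients makes the sets depend on F only, so that one
    countable sum represents F at all points, infinite values included. *)
Lemma greedy_expansion p : F p =
  (\sum_(0 <= k <oo) (k.+1%:R^-1 * \1_(greedy_set k) p)%:E)%E.
Proof.
have t0 k : (0 <= (k.+1%:R^-1 * \1_(greedy_set k) p)%:E :> \bar R)%E.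
  by rewrite lee_fin mulr_ge0.
have partialE n : (\sum_(0 <= k < n) (k.+1%:R^-1 * \1_(greedy_set k) p)%:E = (greedy n p)%:E)%E.
  by rewrite greedyE sumEFin.
apply/eqP; rewrite eq_le; apply/andP; split; last first.
  by apply: lime_le; [exact: is_cvg_nneseries|apply: nearW => n; rewrite partialE; exact: greedy_le].
rewrite leNgt; apply/negP; set L := limn _ => LF.
have Lge n : ((greedy n p)%:E <= L)%E.
  by rewrite -partialE; exact: nneseries_lim_ge.
have Lfin : L \is a fin_num.
  rewrite ge0_fin_numE; first exact: lt_le_trans LF (leey _).
  exact: nneseries_ge0.
have [e e0 eF] : exists2 e : R, 0 < e & ((fine L + e)%:E <= F p)%E.
  move: LF; rewrite -(fineK Lfin); case: (F p) => [r| |//].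
    by rewrite lte_fin => Lr; exists (r - fine L); rewrite ?subr_gt0// addrC subrK.
  by exists 1 => //; rewrite leey.
have [N _ Ne] : \forall k \near \oo, (k.+1%:R^-1 < e).
  have /cvgrPdist_lt/(_ _ e0) := @cvg_harmonic R.
  apply: filterS => k; rewrite sub0r normrN /harmonic/= ger0_norm ?invr_ge0//.
have inG k : (N <= k)%N -> greedy_set k p.
  move=> Nk; rewrite /greedy_set/=; apply: le_trans eF; rewrite lee_fin.
  apply: lerD; last by apply: ltW; exact: Ne.
  by rewrite -lee_fin fineK.
apply: (@dvg_harmonic R); apply: nondecreasing_is_cvgn.
  by apply/nondecreasing_seqP => n; rewrite /series/= big_nat_recr//= lerDl invr_ge0.
exists (series harmonic N + fine L) => _ [n _ <-].
have [Nn|/ltnW nN] := leqP N n; last first.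
  rewrite -[leLHS]addr0; apply: lerD.
    rewrite -subr_ge0 sub_series nN sumr_ge0// => i _.
    by rewrite invr_ge0.
  by rewrite fine_ge0//; exact: nneseries_ge0.
rewrite -lerBlDl sub_series Nn -lee_fin fineK//; apply: le_trans (Lge n).
rewrite lee_fin greedyE (big_cat_nat (leq0n N) Nn)/=; apply: ler_wpDl.
  by rewrite sumr_ge0// => i _; rewrite mulr_ge0.
rewrite !big_nat ler_sum// => i /andP[Ni _].
by rewrite indicE mem_set ?mulr1//; exact: inG.
Qed.

End HarmonicExpansion.

(** * The Campbell formula *)

Section Campbell.
Context (R : realType) (G : topologicalGroupType) (V : nat -> set G).
Hypothesis V_base : precompact_base V.
Hypothesis G_hausdorff : hausdorff_space G.
Context (mG : {sigma_finite_measure set (borel G) -> \bar R}).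
Context d (X : measurableType d) (act : G -> X -> X).
Hypothesis act_measurable :
  measurable_fun setT (fun gx : borel G * X => act gx.1 gx.2).
Context (m : {sigma_finite_measure set X -> \bar R}) (Y : set X).
Hypothesis mY : measurable Y.
Local Open Scope ereal_scope.

Definition return_count (E : set (borel G * X)) x : \bar R :=
  \esum_(g in return_set act Y x) (\1_E (g, act g x))%:E.

(** The Campbell measure of the point process of returns to Y, pushed from the
    pairs (g, x) to the pairs (g, g.x). *)
Definition campbell E := \int[m]_x return_count E x.

Let measurable_shear : measurable_fun setT (fun gx : borel G * X => (gx.1, act gx.1 gx.2)).
Proof. exact: measurable_fun_pair. Qed.

Lemma return_count_ge0 E x : 0 <= return_count E x.
Proof. by apply: esum_ge0 => g _; rewrite lee_fin. Qed.

Lemma ess_measurable_return_count E : measurable E -> ess_measurable m (return_count E).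
Proof.
move=> mE.
pose E' := (fun gx : borel G * X => (gx.1, act gx.1 gx.2)) @^-1` (E `&` (setT `*` Y)).
have mE' : measurable E'.
  rewrite -[E']setTI; apply: measurable_shear => //.
  by apply: measurableI => //; exact: measurableX.
have := ess_measurable_section_count V_base G_hausdorff m mE'.
rewrite (_ : (fun x => _) = return_count E)//; apply/funext => x.
rewrite /return_count esum_mkcond [RHS]esum_mkcond; apply: eq_esum => g _.
case: (boolP (g \in return_set _ _ _)); rewrite ?inE ?notin_setE => gY; last first.
  by rewrite memNset// => -[_ [_]].
rewrite indicE; case: (boolP (_ \in E)); rewrite ?inE ?notin_setE => Eg.
  by rewrite mem_set//; split.
by rewrite memNset// => -[].
Qed.

Let campbell0 : campbell set0 = 0.
Proof.
apply: integral0_eq => x _; apply: esum1 => g _.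
by rewrite indicE in_set0.
Qed.

Let campbell_ge0 E : 0 <= campbell E.
Proof. by apply: integral_ge0 => x _; exact: return_count_ge0. Qed.

Let campbell_sigma_additive : semi_sigma_additive campbell.
Proof.
move=> F mF tF mUF.
rewrite [X in _ --> X](_ : _ = \sum_(n <oo) campbell (F n)).
  by apply/cvg_closeP; split; [exact: is_cvg_nneseries|rewrite closeE].
rewrite -integral_ess_nneseries.
- apply: eq_integral => x _; rewrite /return_count -esum_nneseries//.
  by apply: eq_esum => g _; rewrite indic_bigcup.
- by move=> n x; exact: return_count_ge0.
- by move=> n; exact: ess_measurable_return_count.
Qed.

HB.instance Definition _ := isMeasure.Build _ _ _ campbell
  campbell0 campbell_ge0 campbell_sigma_additive.

Context (tau : {sigma_finite_measure set X -> \bar R}).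
Hypothesis tau_fin : tau setT < +oo.
Hypothesis tau_transverse : transverse_measure mG act m Y tau.
Hypothesis mG_neq0 : mG setT != 0.

Let tau_fin_num C : measurable C -> tau C \is a fin_num.
Proof.
move=> mC; rewrite ge0_fin_numE//; apply: le_lt_trans tau_fin.
by rewrite le_measure ?inE.
Qed.

(** The characterisation of the transverse measure, for the weight that is the
    normalised indicator of B. *)
Lemma campbell_rect_pos (B : set (borel G)) (C : set X) : measurable B -> measurable C ->
  0 < mG B -> mG B < +oo -> campbell (B `*` C) = mG B * tau C.
Proof.
move=> mB mC B0 Boo; have Bfin : mG B \is a fin_num by rewrite ge0_fin_numE// ltW.
have fB0 : (0 < fine (mG B))%R by rewrite fine_gt0// B0.
pose k := ((fine (mG B))^-1)%R.
have k0 : (0 <= k)%R by rewrite invr_ge0 ltW.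
have [tauY] := tau_transverse.
move=> /(_ (fun g => k%:E * (\1_B g)%:E) (fun x => (\1_C x)%:E)).
have tauC : \int[tau]_(y in Y) (\1_C y)%:E = tau C.
  rewrite integral_indic// (measureDI tau mC mY) [X in _ = X + _](_ : _ = 0) ?add0e//.
  by apply: (subset_measure0 _ _ _ tauY) => [||x []//]; [exact: measurableD|exact: measurableC].
rewrite tauC => ->; first last.
- by move=> x _; rewrite lee_fin.
- by apply/measurable_EFinP; exact: measurable_indic.
- rewrite ge0_integralZl_EFin//; last first.
    by apply/measurable_EFinP; exact: measurable_indic.
  have -> : \int[mG]_x (\1_B x)%:E = mG B by rewrite integral_indic// setIT.
  by rewrite -{1}(fineK Bfin) -EFinM mulVf ?gt_eqF.
- by move=> g; rewrite mule_ge0// lee_fin.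
- apply: measurable_funeM; apply/measurable_EFinP; exact: measurable_indic.
have [_ kE] : ess_measurable m (fun x => k%:E * return_count (B `*` C) x) /\
    \int[m]_x (k%:E * return_count (B `*` C) x) = k%:E * campbell (B `*` C).
  apply: integral_ess_scale; first by rewrite lee_fin.
    exact: return_count_ge0.
  by apply: ess_measurable_return_count; exact: measurableX.
rewrite (eq_integral (fun x => k%:E * return_count (B `*` C) x)); last first.
  move=> x _; rewrite /return_count -esumZl//; apply: eq_esum => g _.
  by rewrite muleCA -EFinM !indicE in_setX /= -natrM mulnb andbC.
by rewrite kE muleA -{1}(fineK Bfin) -EFinM divff ?mul1e// gt_eqF.
Qed.

(* A null set B cannot carry a normalised weight. It is compared instead with
   the union of B and K minus B, where K has positive finite measure: adding B
   leaves the measure unchanged. *)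
Let campbell_rect_null (B : set (borel G)) (C : set X) : measurable B -> measurable C ->
  mG B = 0 -> campbell (B `*` C) = 0.
Proof.
move=> mB mC B0.
have [K [mK K0 Koo]] : exists K, [/\ measurable K, 0 < mG K & mG K < +oo].
  have [P PT /all_and2[mP muP]] := sigma_finiteT mG.
  apply: contrapT => nK; move/eqP: mG_neq0; apply.
  rewrite PT; apply/eqP; rewrite eq_le measure_ge0 andbT.
  apply: (@le_trans _ _ (\sum_(n <oo) mG (P n))).
    by apply: measure_sigma_subadditive => //; exact: bigcupT_measurable.
  rewrite eseries0// => n _ _; apply/eqP; rewrite eq_le measure_ge0 andbT leNgt.
  by apply/negP => Pn; apply: nK; exists (P n); split; [exact: mP|exact: Pn|exact: muP].
have mKB : measurable (K `\` B) by exact: measurableD.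
have KBE : mG (K `\` B) = mG K.
  by rewrite (measureDI mG mK mB) [X in _ = _ + X](_ : _ = 0) ?adde0//;
    apply: (subset_measure0 _ _ _ B0) => [||x []//] //; exact: measurableI.
have KUE : mG ((K `\` B) `|` B) = mG K by rewrite measureU0.
have := campbell_rect_pos (measurableU _ _ mKB mB) mC.
rewrite KUE => /(_ K0 Koo).
have -> : ((K `\` B) `|` B) `*` C = ((K `\` B) `*` C) `|` (B `*` C).
  apply/seteqP; split=> [[g x] [[h|h] Cx]|[g x] [[h Cx]|[h Cx]]].
  - by left.
  - by right.
  - by split=> //; left.
  - by split=> //; right.
have -> : campbell (((K `\` B) `*` C) `|` (B `*` C)) =
    campbell ((K `\` B) `*` C) + campbell (B `*` C).
  apply: measureU; [exact: measurableX|exact: measurableX|].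
  by apply/seteqP; split=> // -[g x] [[[/= _ nBg] _] [/= Bg _]].
rewrite (campbell_rect_pos mKB mC) ?KBE// => h.
have fin : mG K * tau C \is a fin_num by rewrite fin_numM ?tau_fin_num// ge0_fin_numE.
by move: h; rewrite addeC => /(congr1 (fun z => z - mG K * tau C)); rewrite addeK// subee.
Qed.

Let campbell_rect (B : set (borel G)) (C : set X) : measurable B -> measurable C ->
  campbell (B `*` C) = mG B * tau C.
Proof.
move=> mB mC; have [P [PT ndP /all_and2[mP muP]]] := (sigma_finiteP _ _).1 (sigma_finiteT mG).
have finE D : measurable D -> mG D < +oo -> campbell (D `*` C) = mG D * tau C.
  move=> mD Doo; have [D0|D0] := eqVneq (mG D) 0.
    by rewrite D0 mul0e campbell_rect_null.
  by apply: campbell_rect_pos => //; rewrite lt0e D0 measure_ge0.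
have BE : B = \bigcup_n (B `&` P n) by rewrite -setI_bigcupr -PT setIT.
have mBP n : measurable (B `&` P n) by exact: measurableI.
have ndBP : nondecreasing_seq (fun n => B `&` P n).
  by move=> i j ij; apply/subsetPset; apply: setIS; apply/subsetPset; exact: ndP.
have mUB : measurable (\bigcup_n (B `&` P n)) by rewrite -BE.
have c1 := nondecreasing_cvg_mu (mu := mG) mBP mUB ndBP.
have c2 : campbell \o (fun n => (B `&` P n) `*` C) @ \oo --> campbell (B `*` C).
  have BCE : B `*` C = \bigcup_n ((B `&` P n) `*` C).
    rewrite {1}BE; apply/seteqP; split=> [[g x] [[n _ h] Cx]|[g x] [n _ [h Cx]]].
      by exists n.
    by split=> //; exists n.
  rewrite BCE; apply: nondecreasing_cvg_mu.
  - by move=> n; exact: measurableX.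
  - by rewrite -BCE; exact: measurableX.
  - move=> i j ij; apply/subsetPset => -[g x] [Bg Cx]; split=> //.
    by have /subsetPset := ndBP _ _ ij; exact.
have {}c1 := cvgeZr (tau_fin_num mC) c1; rewrite -BE in c1.
apply: (cvg_unique _ c2) => //.
rewrite (_ : campbell \o _ = (fun n => (mG \o (fun n => B `&` P n)) n * tau C))//.
apply/funext => n /=; rewrite finE//.
by apply: le_lt_trans (muP n); rewrite le_measure ?inE.
Qed.

(** The Campbell measure and the product measure agree on rectangles. *)
Lemma campbellE E : measurable E -> campbell E = (mG \x tau) E.
Proof. by move=> mE; rewrite (product_measure_unique campbell_rect). Qed.

(** Both sides are countably additive in F, so the expansion of F in indicators
    reduces the formula to sets. *)
Lemma campbell_formula (F : borel G * X -> \bar R) :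
  measurable_fun setT F -> (forall p, 0 <= F p) ->
  ess_measurable m (fun x => \esum_(g in return_set act Y x) F (g, act g x)) /\
  \int[m]_x (\esum_(g in return_set act Y x) F (g, act g x)) =
  \int[mG \x tau]_p F p.
Proof.
move=> mF F0; pose E := greedy_set F.
have mE k : measurable (E k) by exact: measurable_greedy_set.
have c0 k : (0 <= k.+1%:R^-1 :> R)%R by rewrite invr_ge0.
have sumE x : \esum_(g in return_set act Y x) F (g, act g x) =
    \sum_(k <oo) (k.+1%:R^-1)%:E * return_count (E k) x.
  rewrite (eq_esum (fun g _ => greedy_expansion F0 (g, act g x))).
  rewrite esum_nneseries; last by move=> g k; rewrite lee_fin mulr_ge0.
  apply: eq_eseriesr => k _; rewrite -esumZl//.
have h k := integral_ess_scale (k := (k.+1%:R^-1)%:E) (c0 k) (return_count_ge0 (E k))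
  (ess_measurable_return_count (mE k)).
split.
  rewrite (funext sumE); apply: ess_measurable_nneseries => k.
  by have [] := h k.
rewrite (eq_integral _ _ (fun x _ => sumE x)) integral_ess_nneseries; last 2 first.
- by move=> k x; rewrite mule_ge0 ?return_count_ge0// lee_fin.
- by move=> k; have [] := h k.
rewrite (eq_integral _ _ (fun p _ => greedy_expansion F0 p)) integral_nneseries//.
- apply: eq_eseriesr => k _; have [_ ->] := h k.
  under [RHS]eq_integral do rewrite EFinM.
  rewrite ge0_integralZl_EFin// ?integral_indic ?setIT//.
  + by congr (_ * _); exact: campbellE.
  + by apply/measurable_EFinP; exact: measurable_indic.
- by move=> k; apply/measurable_EFinP; exact: measurable_funM.
Qed.

End Campbell.

(** * Integrable weights and null sets of products *)

Section Preliminaries.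
Context (R : realType).
Import numFieldNormedType.Exports.
Local Open Scope ereal_scope.

Lemma measurable_inv : measurable_fun setT (fun r : R => r^-1)%R.
Proof.
rewrite -(setUv [set (0 : R)%R]).
have m0 : measurable [set (0 : R)%R] by [].
apply/measurable_funU => //; first exact: measurableC.
split; first exact: measurable_fun_set1.
apply: open_continuous_measurable_fun.
  by apply: closed_openC; exact: closed_eq.
by move=> x; rewrite inE => /eqP x0; exact: inv_continuous.
Qed.

Lemma esum1_le_counting (T : choiceType) (A : set T) :
  \esum_(g in A) (1 : \bar R) <= counting A.
Proof.
rewrite /counting; case: asboolP => [fA|_]; last exact: leey.
rewrite esum_fset// fsbig_finite//= sumEFin lee_fin.
by rewrite big_const_seq count_predT iter_addr_0.
Qed.

(** Monotonicity without measurability, for the counting functions that occur in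
    the definition of a locally integrable cross section. *)
Lemma ge0_le_integral_nomeas d (T : measurableType d) (mu : {measure set T -> \bar R})
    (f g : T -> \bar R) : (forall x, 0 <= f x) -> (forall x, f x <= g x) ->
  \int[mu]_x f x <= \int[mu]_x g x.
Proof.
move=> f0 fg; rewrite !ge0_integralTE//; last by move=> x; exact: le_trans (fg x).
apply: ereal_sup_le => _ [h /= hf <-]; exists h => // x.
exact: le_trans (fg x).
Qed.

Lemma integral_eq0_ae d (T : measurableType d) (mu : {measure set T -> \bar R})
    (f : T -> \bar R) : (forall x, 0 <= f x) -> ess_measurable mu f ->
  \int[mu]_x f x = 0 -> {ae mu, forall x, f x = 0}.
Proof.
move=> f0 [f' ff']; rewrite (ae_version_integral f0 ff').
case: ff' => mf' f'0 aef h.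
have : ae_eq mu setT f' (cst 0).
  apply/ae_eq_integral_abs => //; rewrite -h.
  by apply: eq_integral => x _; rewrite gee0_abs.
by apply: filterS2 aef => x -> ->.
Qed.

(** A strictly positive integrable weight: the k-th piece of a countable cover
    by sets of finite measure contributes at most 2 ^ - (k + 1). *)
Lemma sigma_finite_weight d (T : measurableType d) (m : {sigma_finite_measure set T -> \bar R}) :
  exists w : T -> \bar R,
    [/\ measurable_fun setT w, forall t, 0 < w t & \int[m]_t w t < +oo].
Proof.
have [P PT /all_and2[mP muP]] := sigma_finiteT m.
pose c k : R := (1 / (2 ^ k.+1)%:R / (1 + fine (m (P k))))%R.
have fm k : (0 <= fine (m (P k)))%R by rewrite fine_ge0.
have c0 k : (0 < c k)%R.
  by rewrite divr_gt0 ?divr_gt0 ?ltr0n ?expn_gt0// ltr_pwDl.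
have t0 k t : 0 <= (c k * \1_(P k) t)%:E by rewrite lee_fin mulr_ge0// ltW.
exists (fun t => \sum_(k <oo) (c k * \1_(P k) t)%:E); split.
- apply: ge0_emeasurable_sum => // k _; apply/measurable_EFinP.
  by apply: measurable_funM => //; exact: measurable_indic.
- move=> t; have [k _ Pkt] : (\bigcup_k P k) t by rewrite -PT.
  apply: (@lt_le_trans _ _ (\sum_(0 <= i < k.+1) (c i * \1_(P i) t)%:E)); last first.
    exact: nneseries_lim_ge.
  rewrite big_nat_recr//= indicE mem_set// mulr1.
  apply: (@lt_le_trans _ _ (c k)%:E); first by rewrite lte_fin.
  by rewrite leeDr// sume_ge0.
rewrite integral_nneseries//; last first.
  move=> k; apply/measurable_EFinP.
  by apply: measurable_funM => //; exact: measurable_indic.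
apply: (@le_lt_trans _ _ 1%:E); last exact: ltry.
apply: le_trans (epsilon_trick0 xpredT ler01); apply: lee_nneseries => k _.
  by move=> _; exact: integral_ge0.
under eq_integral do rewrite EFinM.
rewrite ge0_integralZl_EFin//; last 2 first.
- by apply/measurable_EFinP; exact: measurable_indic.
- exact: ltW.
have -> : \int[m]_t (\1_(P k) t)%:E = m (P k) by rewrite integral_indic// setIT.
rewrite -(@fineK _ (m (P k))); last by rewrite ge0_fin_numE//; exact: muP.
rewrite -EFinM lee_fin /c -(mulrA (1 / (2 ^ k.+1)%:R)%R) ler_piMr//.
by rewrite mulrC ler_pdivrMr ?mul1r ?lerDr// ltr_pwDl.
Qed.

End Preliminaries.

Section ProductAe.
Context (R : realType) d1 d2 (T1 : measurableType d1) (T2 : measurableType d2).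
Local Open Scope ereal_scope.

Lemma ae_product_snd (m1 : {measure set T1 -> \bar R})
    (m2 : {sigma_finite_measure set T2 -> \bar R}) (P : T2 -> Prop) :
  {ae m2, forall y, P y} -> {ae m1 \x m2, forall p, P p.2}.
Proof.
move=> [N [mN mN0 PN]]; exists (setT `*` N); split.
- exact: measurableX.
- by rewrite product_measure1E// mN0 mule0.
- by move=> [x y] /= /PN.
Qed.

Lemma ae_product_sections2 (m1 : {sigma_finite_measure set T1 -> \bar R})
    (m2 : {sigma_finite_measure set T2 -> \bar R}) (P : T1 * T2 -> Prop) :
  {ae m1 \x m2, forall p, P p} -> {ae m2, forall y, {ae m1, forall x, P (x, y)}}.
Proof.
move=> [N [mN mN0 PN]].
have : \int[m1 \x m2]_p (\1_N p)%:E = 0 by rewrite integral_indic// setIT.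
have mI : measurable_fun setT (fun p : T1 * T2 => (\1_N p : R)%:E).
  by apply/measurable_EFinP; exact: measurable_indic.
rewrite fubini_tonelli2//.
move=> /integral_eq0_ae h; have {h} : {ae m2, forall y, fubini_G m1 (fun p => (\1_N p)%:E) y = 0}.
  apply: h; first by move=> y; exact: integral_ge0.
  apply: ex_intro; apply: measurable_ae_version; last by move=> y; exact: integral_ge0.
  exact: measurable_fun_fubini_tonelli_G.
apply: filterS => y /integral_eq0_ae h.
have {h} : {ae m1, forall x, (\1_N (x, y) : R)%:E = 0}.
  apply: h => //.
  apply: ex_intro; apply: measurable_ae_version => //.
  by apply/measurable_EFinP; apply: (@measurableT_comp _ _ _ _ _ _ (\1_N : _ -> R)).
apply: filterS => x; rewrite indicE; case: (boolP (_ \in N)) => [_ [] /eqP|].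
  by rewrite oner_eq0.
by rewrite notin_setE => nN _; apply: contrapT => /PN.
Qed.

Lemma ae_product_sections1 (m1 : {sigma_finite_measure set T1 -> \bar R})
    (m2 : {sigma_finite_measure set T2 -> \bar R}) (P : T1 * T2 -> Prop) :
  {ae m1 \x m2, forall p, P p} -> {ae m1, forall x, {ae m2, forall y, P (x, y)}}.
Proof.
move=> [N [mN mN0 PN]].
have : \int[m1 \x m2]_p (\1_N p)%:E = 0 by rewrite integral_indic// setIT.
have mI : measurable_fun setT (fun p : T1 * T2 => (\1_N p : R)%:E).
  by apply/measurable_EFinP; exact: measurable_indic.
rewrite fubini_tonelli1//.
move=> /integral_eq0_ae h; have {h} : {ae m1, forall x, fubini_F m2 (fun p => (\1_N p)%:E) x = 0}.
  apply: h; first by move=> y; exact: integral_ge0.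
  apply: ex_intro; apply: measurable_ae_version; last by move=> y; exact: integral_ge0.
  exact: measurable_fun_fubini_tonelli_F.
apply: filterS => x /integral_eq0_ae h.
have {h} : {ae m2, forall y, (\1_N (x, y) : R)%:E = 0}.
  apply: h => //.
  apply: ex_intro; apply: measurable_ae_version => //.
  by apply/measurable_EFinP; apply: (@measurableT_comp _ _ _ _ _ _ (\1_N : _ -> R)).
apply: filterS => y; rewrite indicE; case: (boolP (_ \in N)) => [_ [] /eqP|].
  by rewrite oner_eq0.
by rewrite notin_setE => nN _; apply: contrapT => /PN.
Qed.

End ProductAe.

(** * Transfer of null sets between a space and its cross section *)

Lemma continuous_borel_measurable (S T : ptopologicalType) (f : S -> T) :
  continuous f -> measurable_fun setT (f : borel S -> borel T).
Proof.
move=> /continuousP cf; apply: (@measurability _ _ (borel S) (borel T) setT f (@open T)) => //.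
move=> _ [U oU <-]; rewrite setTI; apply: sub_sigma_algebra; exact: cf.
Qed.

Section ActionLemmas.
Context (G : topologicalGroupType) d (X : measurableType d) (act : G -> X -> X).
Hypothesis act_action : is_action act.

Lemma actK g x : act g^-1%g (act g x) = x.
Proof. by case: act_action => act1 actM; rewrite -actM mulVg act1. Qed.

Lemma return_set_act (Y : set X) g h x :
  return_set act Y (act g x) h <-> return_set act Y x (h * g)%g.
Proof. by case: act_action => _ actM; rewrite /return_set/= actM. Qed.

Lemma saturationP (Y : set X) x : saturation act Y x <-> exists g, return_set act Y x g.
Proof.
split=> [[g [y [Yy ->]]]|[g Yg]]; first by exists g^-1%g; rewrite /return_set/= actK.
by exists g^-1%g, (act g x); rewrite actK.
Qed.

Lemma diag_act_action : is_action (diag_act act).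
Proof.
case: act_action => act1 actM; split=> [[x y]|g h [x y]]; rewrite /diag_act/=.
  by rewrite !act1.
by rewrite !actM.
Qed.

End ActionLemmas.

Section Transfer.
Context (R : realType) (G : topologicalGroupType) (V : nat -> set G).
Hypothesis V_base : precompact_base V.
Hypothesis G_hausdorff : hausdorff_space G.
Context (mG : {sigma_finite_measure set (borel G) -> \bar R}).
Hypothesis mG_neq0 : mG setT != 0%E.
Context d (X : measurableType d) (act : G -> X -> X).
Hypothesis act_action : is_action act.
Hypothesis act_measurable :
  measurable_fun setT (fun gx : borel G * X => act gx.1 gx.2).
Local Open Scope ereal_scope.

Lemma measurable_actV :
  measurable_fun setT (fun gx : borel G * X => act gx.1^-1%g gx.2).
Proof.
have mV : measurable_fun setT (fun g : borel G => g^-1%g : borel G).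
  by apply: continuous_borel_measurable; exact: invg_continuous.
apply: (@measurableT_comp _ _ _ _ _ _ (fun gx : borel G * X => act gx.1 gx.2) _
  (fun gx : borel G * X => ((gx.1^-1%g : borel G), gx.2))) => //.
apply: measurable_fun_pair; last exact: measurable_snd.
exact: (measurableT_comp mV).
Qed.

Lemma measurable_act g : measurable_fun setT (act g).
Proof.
apply: (@measurableT_comp _ _ _ _ _ _ (fun gx : borel G * X => act gx.1 gx.2) _
  (fun x : X => ((g : borel G), x))) => //.
exact: measurable_fun_pair.
Qed.

Lemma diag_act_measurable :
  measurable_fun setT (fun gx : borel G * (X * X) => diag_act act gx.1 gx.2).
Proof.
apply: measurable_fun_pair.
- apply: (@measurableT_comp _ _ _ _ _ _ (fun gx : borel G * X => act gx.1 gx.2) _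
    (fun gx : borel G * (X * X) => (gx.1, gx.2.1))) => //.
  apply: measurable_fun_pair => //.
  by apply: (measurableT_comp measurable_fst); exact: measurable_snd.
- apply: (@measurableT_comp _ _ _ _ _ _ (fun gx : borel G * X => act gx.1 gx.2) _
    (fun gx : borel G * (X * X) => (gx.1, gx.2.2))) => //.
  apply: measurable_fun_pair => //.
  by apply: (measurableT_comp measurable_snd); exact: measurable_snd.
Qed.

Context (m : {sigma_finite_measure set X -> \bar R}) (Y : set X).
Hypothesis mY : measurable Y.
Context (tau : {sigma_finite_measure set X -> \bar R}).
Hypothesis tau_fin : tau setT < +oo.
Hypothesis tau_transverse : transverse_measure mG act m Y tau.

Let formula := campbell_formula V_base G_hausdorff act_measurable mY tau_fin tau_transverse mG_neq0.

(** For a null set N of X, the sum over Y_x of the indicator of N, evaluated at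
    g^-1.(g.x) = x, vanishes for almost every x. *)
Lemma ae_total_product (Q : X -> Prop) :
  {ae m, forall x, Q x} -> {ae mG \x tau, forall p, Q (act p.1^-1%g p.2)}.
Proof.
move=> [N [mN mN0 QN]].
pose F (p : borel G * X) : \bar R := (\1_N (act p.1^-1%g p.2))%:E.
have mF : measurable_fun setT F.
  apply/measurable_EFinP; apply: (@measurableT_comp _ _ _ _ _ _ (\1_N : X -> R)).
    exact: measurable_indic.
  exact: measurable_actV.
have F0 p : 0 <= F p by rewrite lee_fin.
have [_] := formula mF F0.
rewrite (@ae_version_integral _ _ _ _ _ (cst 0)); first last.
- split=> //; exists N; split=> // x; apply: contra_notP => Nx.
  by apply: esum1 => g _; rewrite /F/= actK// indicE memNset.
- by move=> x; exact: esum_ge0.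
rewrite integral0 => /esym /(integral_eq0_ae F0 (ex_intro _ _ (measurable_ae_version _ mF F0))).
apply: filterS => p; rewrite /F indicE; case: (boolP (_ \in N)) => [_ [] /eqP|].
  by rewrite oner_eq0.
by rewrite notin_setE => nN _; apply: contrapT => /QN.
Qed.

Lemma ae_product_total (P : borel G * X -> Prop) :
  {ae mG \x tau, forall p, P p} ->
  {ae m, forall x, forall g, return_set act Y x g -> P (g, act g x)}.
Proof.
move=> [N [mN mN0 PN]].
pose F (p : borel G * X) : \bar R := (\1_N p)%:E.
have mF : measurable_fun setT F by apply/measurable_EFinP; exact: measurable_indic.
have F0 p : 0 <= F p by rewrite lee_fin.
have [ess] := formula mF F0.
rewrite (_ : \int[mG \x tau]_p F p = 0); last by rewrite integral_indic// setIT.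
move=> /(integral_eq0_ae _ ess) h.
have {h} := h (fun x => esum_ge0 (fun g _ => F0 (g, act g x))).
apply: filterS => x /(esum_eq0P (fun g => F0 (g, act g x))) h g /h.
rewrite /F indicE; case: (boolP (_ \in N)) => [_ [] /eqP|].
  by rewrite oner_eq0.
by rewrite notin_setE => nN _; apply: contrapT => /PN.
Qed.

(** By Fubini almost every y in Y has some g, indeed almost every g, with
    Q (g^-1.y). *)
Lemma ae_total_transverse (Q : X -> Prop) :
  (forall g x, Q (act g x) -> Q x) ->
  {ae m, forall x, Q x} -> {ae tau, forall y, Q y}.
Proof.
move=> Qinv /ae_total_product /ae_product_sections2; apply: filterS => y [N [mN mN0 QN]].
apply: contrapT => nQ; move/eqP: mG_neq0; apply.
rewrite (_ : setT = N)//; apply/seteqP; split=> // g _; apply: QN => /=.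
by move=> /Qinv.
Qed.

Lemma ae_transverse_total (P : X -> Prop) :
  {ae tau, forall y, P y} ->
  {ae m, forall x, forall g, return_set act Y x g -> P (act g x)}.
Proof. by move=> /(ae_product_snd mG) /ae_product_total. Qed.

End Transfer.

(** * Sigma-finite products *)

Section SigmaFinitePack.
Context (R : realType) d (T : measurableType d).
Context (m : {measure set T -> \bar R}) (m_sigma_finite : sigma_finite setT m).

(** A copy of m that depends on the proof of sigma-finiteness, so that this
    structure can be attached to a measure that is only a variable. *)
Definition with_sigma_finite of sigma_finite setT m : set T -> \bar R := m.

Local Notation m' := (with_sigma_finite m_sigma_finite).

HB.instance Definition _ := Measure.copy m' m.

HB.instance Definition _ := Measure_isSigmaFinite.Build _ _ _ m' m_sigma_finite.

Definition sigma_finite_pack : {sigma_finite_measure set T -> \bar R} := m'.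
End SigmaFinitePack.

Section SigmaFiniteProduct.
Context (R : realType) d1 d2 (T1 : measurableType d1) (T2 : measurableType d2).
Context (m1 : {sigma_finite_measure set T1 -> \bar R}) (m2 : {sigma_finite_measure set T2 -> \bar R}).
Local Open Scope ereal_scope.

Lemma product_sigma_finite : sigma_finite setT (m1 \x m2).
Proof.
have [P [PT ndP /all_and2[mP Poo]]] := (sigma_finiteP _ _).1 (sigma_finiteT m1).
have [Q [QT ndQ /all_and2[mQ Qoo]]] := (sigma_finiteP _ _).1 (sigma_finiteT m2).
exists (fun n => P n `*` Q n); last first.
  move=> n; split; first exact: measurableX.
  rewrite [ltLHS]product_measure1E//; apply: lte_mul_pinfty => //; last exact: Qoo.
  by rewrite ge0_fin_numE//; exact: Poo.
apply/seteqP; split=> // -[x y] _.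
have [i _ Pi] : (\bigcup_n P n) x by rewrite -PT.
have [j _ Qj] : (\bigcup_n Q n) y by rewrite -QT.
exists (maxn i j) => //; split.
  by have /subsetPset := ndP _ _ (leq_maxl i j); exact.
by have /subsetPset := ndQ _ _ (leq_maxr i j); exact.
Qed.

(** Packed by hand, as the structure inferred for a product of measures is the
    one for subprobabilities. *)
Definition sigma_finite_product : {sigma_finite_measure set (T1 * T2)%type -> \bar R} :=
  sigma_finite_pack product_sigma_finite.
End SigmaFiniteProduct.

Section TripleProduct.
Context (R : realType) d1 d2 (T1 : measurableType d1) (T2 : measurableType d2).
Context (m1 : {sigma_finite_measure set T1 -> \bar R}) (m2 : {sigma_finite_measure set T2 -> \bar R}).
Context (F : T1 * T2 -> \bar R).
Local Open Scope ereal_scope.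
Hypothesis mF : measurable_fun setT F.
Hypothesis F0 : forall p, 0 <= F p.

Let mFg x : measurable_fun setT (fun y => F (x, y)).
Proof. exact: (measurableT_comp mF). Qed.

Let mG1 : measurable_fun setT (fun p : T1 * (T2 * T2) => F (p.1, p.2.1)).
Proof.
apply: (measurableT_comp mF); apply: measurable_fun_pair => //.
by apply: (measurableT_comp measurable_fst); exact: measurable_snd.
Qed.

Let mG2 : measurable_fun setT (fun p : T1 * (T2 * T2) => F (p.1, p.2.2)).
Proof.
apply: (measurableT_comp mF); apply: measurable_fun_pair => //.
by apply: (measurableT_comp measurable_snd); exact: measurable_snd.
Qed.

Local Notation m22 := (sigma_finite_product m2 m2).

Lemma integral_triple_fst :
  \int[m1 \x sigma_finite_product m2 m2]_p F (p.1, p.2.1) = m2 setT * \int[m1 \x m2]_p F p.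
Proof.
transitivity (\int[m1]_x fubini_F m22 (fun p : T1 * (T2 * T2) => F (p.1, p.2.1)) x).
  exact: (fubini_tonelli1 (m1 := m1) (m2 := m22) _ mG1 (fun p => F0 _)).
rewrite (fubini_tonelli1 _ mF F0).
rewrite -ge0_integralZl//; first last.
- by move=> x _; exact: integral_ge0.
- exact: measurable_fun_fubini_tonelli_F.
apply: eq_integral => x _; rewrite /fubini_F/=.
rewrite (fubini_tonelli1 (fun y : T2 * T2 => F (x, y.1)))//; last first.
  by apply: (measurableT_comp (mFg x)); exact: measurable_fst.
rewrite -ge0_integralZl//; apply: eq_integral => y _; rewrite /fubini_F/=.
by rewrite integral_cst// muleC.
Qed.

Lemma integral_triple_snd :
  \int[m1 \x sigma_finite_product m2 m2]_p F (p.1, p.2.2) = m2 setT * \int[m1 \x m2]_p F p.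
Proof.
transitivity (\int[m1]_x fubini_F m22 (fun p : T1 * (T2 * T2) => F (p.1, p.2.2)) x).
  exact: (fubini_tonelli1 (m1 := m1) (m2 := m22) _ mG2 (fun p => F0 _)).
rewrite (fubini_tonelli1 _ mF F0).
rewrite -ge0_integralZl//; first last.
- by move=> x _; exact: integral_ge0.
- exact: measurable_fun_fubini_tonelli_F.
apply: eq_integral => x _; rewrite /fubini_F/=.
rewrite (fubini_tonelli1 (fun y : T2 * T2 => F (x, y.2)))//; last first.
  by apply: (measurableT_comp (mFg x)); exact: measurable_snd.
rewrite (eq_integral (fun=> \int[m2]_y F (x, y)))//.
by rewrite integral_cst// muleC.
Qed.
End TripleProduct.

Section TripleProductAe.
Context (R : realType) d1 d2 (T1 : measurableType d1) (T2 : measurableType d2).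
Context (m1 : {sigma_finite_measure set T1 -> \bar R}) (m2 : {sigma_finite_measure set T2 -> \bar R}).
Local Open Scope ereal_scope.

Lemma ae_triple (P : T1 * T2 -> Prop) : {ae m1 \x m2, forall p, P p} ->
  {ae m1 \x sigma_finite_product m2 m2, forall p, P (p.1, p.2.1) /\ P (p.1, p.2.2)}.
Proof.
move=> [N [mN mN0 PN]].
pose F (p : T1 * T2) : \bar R := (\1_N p)%:E.
have mF : measurable_fun setT F by apply/measurable_EFinP; exact: measurable_indic.
have F0 p : 0 <= F p by rewrite lee_fin.
have iF0 : \int[m1 \x m2]_p F p = 0 by rewrite integral_indic// setIT.
have mF1 : measurable_fun setT (fun p : T1 * (T2 * T2) => F (p.1, p.2.1)).
  apply: (measurableT_comp mF); apply: measurable_fun_pair => //.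
  by apply: (measurableT_comp measurable_fst); exact: measurable_snd.
have mF2 : measurable_fun setT (fun p : T1 * (T2 * T2) => F (p.1, p.2.2)).
  apply: (measurableT_comp mF); apply: measurable_fun_pair => //.
  by apply: (measurableT_comp measurable_snd); exact: measurable_snd.
have := integral_triple_fst m1 m2 mF F0; rewrite iF0 mule0.
move=> /(integral_eq0_ae (fun p => F0 _) (ex_intro _ _ (measurable_ae_version _ mF1 (fun p => F0 _)))) h1.
have := integral_triple_snd m1 m2 mF F0; rewrite iF0 mule0.
move=> /(integral_eq0_ae (fun p => F0 _) (ex_intro _ _ (measurable_ae_version _ mF2 (fun p => F0 _)))).
have FP p : F p = 0 -> P p.
  rewrite /F indicE; case: (boolP (p \in N)) => [_ [] /eqP|]; first by rewrite oner_eq0.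
  by rewrite notin_setE => nN _; apply: contrapT => /PN.
by apply: filterS2 h1 => p h1 h2; split; exact: FP.
Qed.
End TripleProductAe.

(** The function 1 - A is nonnegative with vanishing integral. *)
Lemma integral_total_mass_ae_eq1 (R : realType) d (T : measurableType d)
    (m : {measure set T -> \bar R}) (A : T -> \bar R) :
  (forall x, 0 <= A x <= 1)%E -> ess_measurable m A -> (m setT < +oo)%E ->
  (\int[m]_x A x = m setT)%E -> {ae m, forall x, A x = 1%E}.
Proof.
move=> A01 [A' AA'] moo iA.
have A0 x : (0 <= A x)%E by case/andP: (A01 x).
have [mA' A'0 aeA] := AA'.
pose f x := maxe (1 - A' x)%E 0%E.
have mf : measurable_fun setT f.
  apply: measurable_maxe => //; apply: emeasurable_funB => //.
have f0 x : (0 <= f x)%E by rewrite le_max lexx orbT.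
have ff : {ae m, forall x, (f x + A' x = 1)%E}.
  apply: filterS aeA => x; rewrite /f => AxA'.
  have /andP[] := A01 x; rewrite AxA' => a0 a1.
  have Afin : A' x \is a fin_num by rewrite ge0_fin_numE//; apply: le_lt_trans a1 (ltry _).
  by rewrite max_l ?sube_ge0 ?orbT// ?subeK// Afin.
have if0 : (\int[m]_x f x = 0)%E.
  have : (\int[m]_x (f x + A' x) = m setT)%E.
    rewrite (@ge0_ae_eq_integral _ _ _ _ _ _ (cst 1%E))//.
    - by rewrite integral_cst// mul1e.
    - exact: emeasurable_funD.
    - by move=> x _; rewrite adde_ge0.
    - by apply: filterS ff => x /= ->.
  rewrite ge0_integralD// -(ae_version_integral A0 AA') iA => h.
  have mfin : m setT \is a fin_num by rewrite ge0_fin_numE.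
  by move: h => /(congr1 (fun z => z - m setT)%E); rewrite addeK// subee.
have h := integral_eq0_ae f0 (ex_intro _ _ (measurable_ae_version _ mf f0)) if0.
near=> x.
have fx : f x = 0%E by near: x.
have AxA' : A x = A' x by near: x.
have : (f x + A' x = 1)%E by near: x.
by rewrite fx add0e AxA'.
Unshelve. all: by end_near. Qed.

(** * Intensity and intersection covolume *)

Section Intersection.
Context (R : realType) (G : topologicalGroupType) (V : nat -> set G).
Hypothesis V_base : precompact_base V.
Hypothesis G_hausdorff : hausdorff_space G.
Context (mG : {sigma_finite_measure set (borel G) -> \bar R}).
Hypothesis mG_neq0 : mG setT != 0%E.
Hypothesis mG_compact : forall K : set G, compact K -> (mG K < +oo)%E.
Context d (X : measurableType d) (act : G -> X -> X).
Hypothesis act_action : is_action act.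
Hypothesis act_measurable :
  measurable_fun setT (fun gx : borel G * X => act gx.1 gx.2).
Context (mu : probability X R) (Y : set X).
Hypothesis Y_cross_section : locally_integrable_cross_section act mu Y.
Context (muY : {sigma_finite_measure set X -> \bar R}).
Hypothesis muY_transverse : transverse_measure mG act mu Y muY.
Context (mu2 : {sigma_finite_measure set (X * X)%type -> \bar R}).
Hypothesis mu2_conull : mu2.-negligible (~` pair_saturation act Y).
Hypothesis mu2_transverse :
  transverse_measure mG (diag_act act) mu2 (Y `*` Y) (muY \x muY)%E.
Local Open Scope ereal_scope.

Let mY : measurable Y. Proof. by case: Y_cross_section. Qed.

Lemma muY_setT : muY setT = muY Y.
Proof.
have [muYC _] := muY_transverse.
rewrite -(setUv Y) measureU//; last by rewrite setICr.
  by rewrite [X in _ + X = _](_ : _ = 0) ?adde0.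
exact: measurableC.
Qed.

(** Local integrability, applied to a compact set of positive Haar measure. *)
Lemma muY_fin : muY setT < +oo.
Proof.
have mclV i : measurable (closure (V i) : set (borel G)).
  rewrite -[closure (V i)]setCK; apply: measurableC; apply: sub_sigma_algebra.
  exact/closed_openC/closed_closure.
have [i clVi] : exists i, 0 < mG (closure (V i)).
  apply: contrapT => /forallNP h; move/eqP: mG_neq0; apply.
  apply/eqP; rewrite -measure_le0.
  apply: (@le_trans _ _ (\sum_(i <oo) mG (closure (V i)))); last first.
    rewrite eseries0// => i _ _; apply/eqP; rewrite -measure_le0 leNgt.
    by apply/negP; exact: h.
  apply: measure_sigma_subadditive => // g _.
  by have [i Vg] := base_cover V_base g; exists i => //; exact: subset_closure.
have clV_compact : compact (closure (V i)) by case: V_base.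
have := campbell_rect_pos V_base G_hausdorff act_measurable mY muY_transverse (mclV i) measurableT
  clVi (mG_compact clV_compact).
have : campbell act mu Y (closure (V i) `*` setT) < +oo.
  have [_ _ _ /(_ _ clV_compact)] := Y_cross_section; apply: le_lt_trans.
  apply: ge0_le_integral_nomeas => x; first exact: return_count_ge0.
  apply: le_trans (esum1_le_counting _ _); rewrite /return_count.
  rewrite esum_mkcond [leRHS]esum_mkcond; apply: le_esum => g _.
  rewrite indicE; case: ifPn => [/set_mem Yg|]; last by case: ifPn.
  case: ifPn => [_|/negP nK]; first by rewrite lee_fin; case: (_ \in _).
  rewrite memNset// => -[/= Kg _]; apply: nK; apply/mem_set; split=> //.
by move=> + h; rewrite h ltNge leye_eq; apply: contraNT; rewrite -leNgt leye_eq => /eqP ->; rewrite gt0_muley.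
Qed.

Local Notation muY2 := (sigma_finite_product muY muY).

Let mu2_transverse' : transverse_measure mG (diag_act act) mu2 (Y `*` Y) muY2.
Proof. exact: mu2_transverse. Qed.

Let muY2_fin : muY2 setT < +oo.
Proof.
rewrite -setXTT [ltLHS]product_measure1E//.
by rewrite lte_mul_pinfty// ?muY_fin// ge0_fin_numE// muY_fin.
Qed.

Let mYY : measurable (Y `*` Y). Proof. exact: measurableX. Qed.

Let diag_action := diag_act_action act_action.
Let diag_measurable := diag_act_measurable act_measurable.

(** The measure mu2 is carried by the saturation of Y x Y, whose points are the
    pairs with a common return. *)
Lemma mu2_common_return : {ae mu2, forall p : X * X, exists g,
  return_set act Y p.1 g /\ return_set act Y p.2 g}.
Proof.
apply: negligibleS mu2_conull => p; apply: contra_not.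
by move=> /(saturationP diag_action)[g [? ?]]; exists g.
Qed.

(** A null set of X, carried to G x Y and pulled back to G x Y x Y along either
    coordinate, stays null; read on X x X this says that almost every pair
    avoids it as soon as there is a common return. *)
Lemma ae_mu2_coordinates (Q : X -> Prop) :
  {ae mu, forall x, Q x} -> {ae mu2, forall p, Q p.1 /\ Q p.2}.
Proof.
move=> aeQ.
have := ae_total_product V_base G_hausdorff mG_neq0 act_action act_measurable mY muY_fin
  muY_transverse aeQ.
move=> /ae_triple.
move=> /(ae_product_total V_base G_hausdorff mG_neq0 diag_measurable mYY muY2_fin mu2_transverse').
apply: filterS2 mu2_common_return => p [g [Yg1 Yg2]] /(_ g) h.
by have := h (conj Yg1 Yg2); rewrite /= !actK.
Qed.

Definition return_weight (w : G -> \bar R) x := \esum_(g in return_set act Y x) w g.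

(** The function q is a Borel version of 1 / sum_(g in Y_x) w (g), set to zero on
    an exceptional null set and where the sum is zero or infinite; thus q times
    the sum is at most 1 everywhere, and is 1 almost everywhere. *)
Lemma normalized_weight : exists (w : borel G -> \bar R) (q : X -> R),
  [/\ [/\ measurable_fun setT w, forall g, 0 < w g, measurable_fun setT q &
          forall x, (0 <= q x)%R],
      forall x, (q x)%:E * return_weight w x <= 1 &
      {ae mu, forall x, (q x)%:E * return_weight w x = 1}].
Proof.
have [w [mw w0 woo]] := sigma_finite_weight mG.
have w0' g : 0 <= w g by exact: ltW.
have mwF : measurable_fun setT (fun p : borel G * X => w p.1).
  by apply: (measurableT_comp mw); exact: measurable_fst.
have [] := campbell_formula V_base G_hausdorff act_measurable mY muY_fin muY_transverse mG_neq0
  mwF (fun p => w0' p.1).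
rewrite -/(return_weight w) => -[S' SS'].
have S0 x : 0 <= return_weight w x by exact: esum_ge0.
have -> : \int[mG \x muY]_p w p.1 = muY setT * \int[mG]_g w g.
  rewrite fubini_tonelli1// -ge0_integralZl//.
  by apply: eq_integral => g _; rewrite /fubini_F/= integral_cst// muleC.
rewrite (ae_version_integral S0 SS') => intS'.
have [mS' S'0 aeS] := SS'.
have [N [mN mN0 SN]] := aeS.
have intS'oo : \int[mu]_x S' x < +oo.
  by rewrite intS' lte_mul_pinfty// ge0_fin_numE// muY_fin.
have S'fin : {ae mu, forall x, S' x \is a fin_num}.
  have : mu.-integrable setT S'.
    apply/integrableP; split=> //; apply: le_lt_trans intS'oo.
    by rewrite (eq_integral S')// => x _; rewrite gee0_abs.
  by move=> /(integrable_ae measurableT); apply: filterS => x; apply.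
(* As fine +oo = 0 and 0^-1 = 0, this is 0 where S' is 0 or infinite. *)
exists w, (fun x => (fine (S' x))^-1 * \1_(~` N) x)%R.
have eqS x : ~ N x -> return_weight w x = S' x.
  by move=> nN; apply: contrapT => h; exact/nN/SN.
split; first split=> //.
- apply: measurable_funM; last by apply: measurable_indic; exact: measurableC.
  apply: (@measurableT_comp _ _ _ _ _ _ (fun r : R => r^-1)%R _ (fun x => fine (S' x))).
    exact: measurable_inv.
  by apply: measurableT_comp.
- by move=> x; rewrite mulr_ge0// invr_ge0 fine_ge0.
- move=> x; rewrite indicE; case: (boolP (x \in _)) => [/set_mem nN|_].
    rewrite mulr1 (eqS _ nN).
    have [S'x0|S'x0] := eqVneq (S' x) 0; first by rewrite S'x0 mule0.
    have [->|S'xoo] := eqVneq (S' x) +oo; first by rewrite invr0 mul0e.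
    have fS : S' x \is a fin_num by rewrite ge0_fin_numE// ltey.
    rewrite -{2}(fineK fS) -EFinM mulVf//.
    by rewrite fine_eq0.
  by rewrite mulr0 mul0e.
have [_ sat _ _] := Y_cross_section.
have aesat : {ae mu, forall x, saturation act Y x} by [].
have aeN : {ae mu, forall x, ~ N x}.
  by exists N; split=> // x /contrapT.
near=> x.
have nN : ~ N x by near: x.
have fS : S' x \is a fin_num by near: x.
have : saturation act Y x by near: x.
move=> /(saturationP act_action)[g Yg].
rewrite indicE mem_set// mulr1 (eqS _ nN) -{2}(fineK fS) -EFinM mulVf// fine_eq0//.
rewrite gt_eqF// -(eqS _ nN); apply: lt_le_trans (w0 g) _.
by rewrite -[leLHS]esum_set1//; apply: esum_subset => _ ->.
Unshelve. all: by end_near. Qed.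

Section Overlap.
Variables (w : borel G -> \bar R) (q : X -> R).
Hypothesis mw : measurable_fun setT w.
Hypothesis w0 : forall g, 0 < w g.
Hypothesis mq : measurable_fun setT q.
Hypothesis q0 : forall x, (0 <= q x)%R.
Hypothesis qw_le1 : forall x, (q x)%:E * return_weight w x <= 1.
Hypothesis qw_eq1 : {ae mu, forall x, (q x)%:E * return_weight w x = 1}.

Let w0' g : 0 <= w g. Proof. exact: ltW. Qed.

(** The share of the total weight of the returns of p.1 that is carried by
    returns common to p.1 and p.2. *)
Definition overlap (p : X * X) : \bar R :=
  \esum_(g in return_set act Y p.1 `&` return_set act Y p.2) ((q p.1)%:E * w g).

Let F (p : borel G * X) : \bar R := (q (act p.1^-1%g p.2))%:E * w p.1.

Let mF : measurable_fun setT F.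
Proof.
apply: emeasurable_funM.
  apply/measurable_EFinP; apply: (measurableT_comp mq).
  exact: measurable_actV.
by apply: (measurableT_comp mw); exact: measurable_fst.
Qed.

Let F0 p : 0 <= F p.
Proof. by rewrite mule_ge0// lee_fin. Qed.

Lemma overlap_ge0 p : 0 <= overlap p.
Proof. by apply: esum_ge0 => g _; rewrite mule_ge0// lee_fin. Qed.

Lemma overlap_le1 p : overlap p <= 1.
Proof.
apply: le_trans (qw_le1 p.1); rewrite /return_weight -esumZl//.
by apply: esum_subset => g [].
Qed.

(** Seen from Y x Y, the summand depends on the first point only; integrating
    over the second one gives the factor muY setT, and what remains is the
    integral of q times the sum of w, which is 1 since mu is a probability. *)
Lemma overlap_integral : ess_measurable mu2 overlap /\ \int[mu2]_p overlap p = muY setT.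
Proof.
have [_ intF] := campbell_formula V_base G_hausdorff act_measurable mY muY_fin muY_transverse
  mG_neq0 mF F0.
have intF1 : \int[mG \x muY]_p F p = 1.
  rewrite -intF (@ae_version_integral _ _ _ _ _ (cst 1)).
  - by rewrite integral_cst// mul1e; exact: probability_setT.
  - by move=> x; exact: esum_ge0.
  split=> //; apply: filterS qw_eq1 => x qw1.
  rewrite -qw1 /return_weight -esumZl//; apply: eq_esum => g _.
  by rewrite /F/= actK.
have mF3 : measurable_fun setT (fun p : borel G * (X * X) => F (p.1, p.2.1)).
  apply: (measurableT_comp mF); apply: measurable_fun_pair => //.
  by apply: (measurableT_comp measurable_fst); exact: measurable_snd.
have := campbell_formula V_base G_hausdorff diag_measurable mYY muY2_fin mu2_transverse'
  mG_neq0 mF3 (fun p => F0 _).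
rewrite (integral_triple_fst mG muY mF F0) intF1 mule1.
rewrite (_ : (fun p : X * X => _) = overlap)//.
apply/funext => p; apply: eq_esum => g _; by rewrite /F/= actK.
Qed.

(** A return of p.1 that is not one of p.2 would have positive weight, and the
    share of the common returns would be less than 1. *)
Lemma return_subset_of_overlap p : overlap p = 1 ->
  return_set act Y p.1 `<=` return_set act Y p.2.
Proof.
move=> A1 g Yg1; apply: contrapT => nYg2.
have split_sum := esumID (return_set act Y p.2) (return_set act Y p.1)
  (fun h => (q p.1)%:E * w h) (fun h _ => mule_ge0 (q0 p.1 : 0 <= (q p.1)%:E) (w0' h)).
have le1 := qw_le1 p.1; rewrite /return_weight -esumZl// split_sum -/(overlap p) A1 in le1.
have rest0 : \esum_(h in return_set act Y p.1 `&` ~` return_set act Y p.2)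
    ((q p.1)%:E * w h) = 0.
  apply/eqP; rewrite eq_le esum_ge0 ?andbT; last by move=> h _; rewrite mule_ge0// lee_fin.
  by rewrite -(@leeD2lE _ 1)// adde0.
have : (q p.1)%:E * w g = 0.
  by apply: (esum_eq0P _ rest0) => // h; rewrite mule_ge0// lee_fin.
move/eqP; rewrite mule_eq0 => /orP[/eqP q00|/eqP wg0]; last by have := w0 g; rewrite wg0 ltxx.
move: A1; rewrite /overlap esum1 => [/eqP|h _]; first by rewrite eq_sym onee_eq0.
by rewrite q00 mul0e.
Qed.

Lemma overlap_eq1 p : (q p.1)%:E * return_weight w p.1 = 1 ->
  return_set act Y p.1 = return_set act Y p.2 -> overlap p = 1.
Proof.
move=> qw1 E; rewrite /overlap -E setIid.
by rewrite -qw1 /return_weight -esumZl.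
Qed.

End Overlap.

Theorem intensity_le_covolume : muY Y <= mu2 setT.
Proof.
have [w [q [[mw w0 mq q0] qw1 aeqw]]] := normalized_weight.
have [_] := overlap_integral mw w0 mq q0 aeqw.
rewrite -muY_setT => <-.
rewrite -[leRHS]mul1e -integral_cst//.
apply: ge0_le_integral_nomeas => p; first exact: overlap_ge0.
exact: overlap_le1.
Qed.

Theorem equality_return_subset : mu2 setT = muY Y ->
  {ae mu2, forall p, return_set act Y p.1 `<=` return_set act Y p.2}.
Proof.
move=> mu2E; have [w [q [[mw w0 mq q0] qw1 aeqw]]] := normalized_weight.
have [ess intA] := overlap_integral mw w0 mq q0 aeqw.
have : {ae mu2, forall p, overlap w q p = 1}.
  apply: integral_total_mass_ae_eq1 => //.
  - by move=> p; rewrite overlap_ge0// overlap_le1.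
  - by have := muY_fin; rewrite muY_setT -mu2E.
  - by rewrite intA muY_setT -mu2E.
by apply: filterS => p; exact: return_subset_of_overlap.
Qed.

Theorem equality_of_return_eq :
  {ae mu2, forall p, return_set act Y p.1 = return_set act Y p.2} ->
  mu2 setT = muY Y.
Proof.
move=> aeE; have [w [q [[mw w0 mq q0] qw1 aeqw]]] := normalized_weight.
have [ess intA] := overlap_integral mw w0 mq q0 aeqw.
rewrite -muY_setT -intA (@ae_version_integral _ _ _ _ _ (cst 1)).
- by rewrite integral_cst// mul1e.
- by move=> p; exact: overlap_ge0.
split=> //; apply: filterS2 aeE (ae_mu2_coordinates aeqw) => p E [qw _].
exact: overlap_eq1.
Qed.

(** Inclusion for almost every ordered pair suffices: by Fubini some y0
    has Y_y0 contained in Y_y, and containing it, for almost every y. *)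
Theorem equality_return_ae_constant : mu2 setT = muY Y ->
  exists L : set G, {ae muY, forall y, return_set act Y y = L}.
Proof.
move=> /equality_return_subset sub2.
have sub : {ae muY2, forall p, return_set act Y p.1 `<=` return_set act Y p.2}.
  apply: (ae_total_transverse V_base G_hausdorff mG_neq0 diag_action diag_measurable mYY muY2_fin
    mu2_transverse' _ sub2) => g [x1 x2] /= h k k1.
  have := h (k * g^-1)%g; rewrite !(return_set_act act_action) !mulgVK.
  exact.
have sub1 := ae_product_sections1 sub.
have := filterI sub1 (ae_product_sections2 sub).
(* If muY vanishes, everything holds almost everywhere. *)
have [muY0|muYn0] := eqVneq (muY setT) 0.
  move=> _; exists set0; exists setT; split=> //.
move=> [N [mN mN0 h]].
have [y0 ny0] : exists y, ~ N y.
  apply: contrapT => /forallNP nN; move/eqP: muYn0; apply; rewrite -mN0; congr (muY _).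
  by apply/seteqP; split=> // y _; apply: contrapT; exact: nN.
have [h1 h2] : {ae muY, forall y, return_set act Y y0 `<=` return_set act Y y} /\
    {ae muY, forall x, return_set act Y x `<=` return_set act Y y0}.
  by apply: contrapT => nh; apply: ny0; exact: h.
exists (return_set act Y y0); apply: filterS2 h1 h2 => y h1 h2.
by apply/seteqP; split.
Qed.

End Intersection.

(** * The coset space *)

Section CosetSpaceLemmas.
Context (G : topologicalGroupType) (Gamma : groupClosed G).
Local Open Scope quotient_scope.

Lemma coset_piP (a b : G) : coset_pi Gamma a = coset_pi Gamma b <-> (a / b)%g \in Gamma.
Proof.
by split=> /(@eqmodP _ (coset_equiv Gamma) a b).
Qed.

Lemma coset_pi_repr (q : coset_space Gamma) :
  coset_pi Gamma (repr (q : {eq_quot coset_equiv Gamma})) = q.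
Proof. exact: reprK. Qed.

Lemma coset_act_pi g (a : G) :
  coset_act g (coset_pi Gamma a) = coset_pi Gamma (a * g^-1)%g.
Proof.
apply/coset_piP; rewrite invgM invgK mulgA mulgVK.
by apply/coset_piP; exact: coset_pi_repr.
Qed.

Lemma return_set_coset (q : borel (coset_space Gamma)) :
  return_set (@coset_act G Gamma) [set coset_pi Gamma 1%g] q = [set g | coset_pi Gamma g = q].
Proof.
rewrite -[q]coset_pi_repr; set a := repr _.
apply/seteqP; split=> g; rewrite /return_set/= coset_act_pi => /coset_piP.
  rewrite invg1 mulg1 => ag; apply/coset_piP.
  by rewrite -[_ \in _]gpredV invgM invgK.
move=> ga; apply/coset_piP; rewrite invg1 mulg1.
by rewrite -[_ \in _]gpredV invgM invgK.
Qed.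

Lemma open_coset_space (U : set (coset_space Gamma)) :
  open U = open (coset_pi Gamma @^-1` U).
Proof. by []. Qed.

Lemma continuous_coset_act g : continuous (coset_act g : coset_space Gamma -> coset_space Gamma).
Proof.
apply/continuousP => U; rewrite !open_coset_space => oU.
rewrite (_ : _ @^-1` _ = (fun a => a * g^-1)%g @^-1` (coset_pi Gamma @^-1` U)); last first.
  by apply/seteqP; split=> a; rewrite /= coset_act_pi.
move: (coset_pi Gamma @^-1` U) oU; apply/continuousP => a.
apply: (@continuous2_cvg _ G G G (nbhs a) _ id (fun=> g^-1%g) (fun x y => x * y)%g a g^-1%g).
- exact: (mulg_continuous (a, g^-1%g)).
- exact: cvg_id.
- exact: cvg_cst.
Qed.

Lemma measurable_coset_act g : measurable_fun setT (@coset_act G Gamma g).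
Proof.
exact: (@continuous_borel_measurable (coset_space Gamma) (coset_space Gamma) _ (@continuous_coset_act g)).
Qed.

End CosetSpaceLemmas.

(** Invariance under right translation by its own elements makes L closed under
    inverses as well, taking h = g^-1. *)
Lemma subgroup_of_set (G : topologicalGroupType) (L : set G) : L 1%g ->
  (forall g h, L g -> L h <-> L (h * g)%g) ->
  exists Gamma : groupClosed G, forall g, (g \in Gamma) = `[< L g >].
Proof.
move=> L1 LM; pose S : {pred G} := fun g => `[< L g >].
have LV g : L g -> L g^-1%g by move=> Lg; apply/(LM _ _ Lg); rewrite mulVg.
have Sgrp : group_closed S.
  split; first exact/asboolP.
  move=> g h /asboolP Lg /asboolP Lh; apply/asboolP.
  by apply/(LM _ _ Lh); rewrite mulgVK.
pose Gamma : groupClosed G := HB.pack S (isInvClosed.Build G S (group_closedV Sgrp))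
  (isMul1Closed.Build G S Sgrp.1) (isMulClosed.Build G S (group_closedM Sgrp)).
by exists Gamma.
Qed.

(** A precompact neighbourhood of g meets Gamma in finitely many points, and the
    points other than g can be removed from it. *)
Lemma discrete_of_locally_finite (G : topologicalGroupType) (V : nat -> set G)
    (Gamma : groupClosed G) : precompact_base V -> hausdorff_space G ->
  locally_finite_set [set g | g \in Gamma] -> discrete_subgroup Gamma.
Proof.
move=> V_base hG lfG g Gg; have [oV cV _] := V_base.
have [i Vg] := base_cover V_base g.
pose F := ([set h | h \in Gamma] `&` closure (V i)) `\ g.
have fF : finite_set F by apply: sub_finite_set (lfG _ (cV i)); exact: subDsetl.
have cF : closed F.
  by move: F fF; apply/accessible_finite_set_closed; exact: hausdorff_accessible.
exists (V i `&` ~` F).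
  split; first by apply: openI; [exact: oV|exact: closed_openC].
  by split=> // -[_ /(_ erefl)].
apply/seteqP; split=> [h [[Vh nF] /= Gh]|_ ->].
  apply: contrapT => hg; apply: nF; split=> //; split=> //.
  exact: subset_closure.
by split=> //; split=> // -[_ /(_ erefl)].
Qed.

(** * Factors onto a coset space *)

Lemma ae_eq_measure (R : realType) d (T : measurableType d) (m : {measure set T -> \bar R})
    (A B : set T) : measurable A -> measurable B ->
  {ae m, forall x, A x <-> B x} -> m A = m B.
Proof.
move=> mA mB AB.
suff : (\int[m]_x (\1_A x)%:E = \int[m]_x (\1_B x)%:E)%E by rewrite !integral_indic// !setIT.
apply: ge0_ae_eq_integral => //; try by apply/measurable_EFinP; exact: measurable_indic.
apply: filterS AB => x AB _; rewrite !indicE; congr (_%:R%:E); congr nat_of_bool.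
by apply/idP/idP; rewrite !inE => /AB.
Qed.

Lemma ae_probability_ex (R : realType) d (T : measurableType d) (P : probability T R)
    (Q : T -> Prop) : {ae P, forall x, Q x} -> exists x, Q x.
Proof.
move=> [N [mN PN QN]]; apply: contrapT => /forallNP nQ.
have : P setT = 1%E by exact: probability_setT.
rewrite (_ : setT = N) ?PN; last by apply/seteqP; split=> // x _; apply: QN; exact: nQ.
by move/esym/eqP; rewrite onee_eq0.
Qed.

Section Factor.
Context (R : realType) (G : topologicalGroupType) (V : nat -> set G).
Hypothesis V_base : precompact_base V.
Context d (X : measurableType d) (act : G -> X -> X).
Hypothesis act_action : is_action act.
Hypothesis act_measurable :
  measurable_fun setT (fun gx : borel G * X => act gx.1 gx.2).
Context (mu : probability X R) (Y : set X).
Hypothesis mY : measurable Y.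
Context (Gamma : groupClosed G).

(** The preimage of an open set U of cosets consists of the x for which Y_x
    meets some basic open set contained in the union of the cosets in U.
    Whether Y_x meets a basic open set is measurable up to a null set by
    projection; on the countably many exceptional null sets the map is made
    constant, so that it becomes Borel everywhere. *)
Lemma coset_factor_measurable :
  {ae mu, forall x, exists h, return_set act Y x = [set g | coset_pi Gamma g = coset_pi Gamma h]} ->
  exists2 phi : X -> borel (coset_space Gamma), measurable_fun setT phi &
    {ae mu, forall x, return_set act Y x = [set g | coset_pi Gamma g = phi x]}.
Proof.
move=> [N [mN mN0 YN]].
have /choice[h hP] x : exists h, ~ N x ->
    return_set act Y x = [set g | coset_pi Gamma g = coset_pi Gamma h].
  have [Nx|nN] := pselect (N x); first by exists 1%g.
  have [h hE] : exists h, return_set act Y x = [set g | coset_pi Gamma g = coset_pi Gamma h].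
    by apply: contrapT => nh; exact/nN/YN.
  by exists h.
pose hit i := [set x | exists g, (V i `*` setT `&`
  (fun gx : borel G * X => act gx.1 gx.2) @^-1` Y) (g, x)].
have /choice[B /choice[M BM]] i : ess_measurable_set mu (hit i).
  apply: (measurable_projection V_base); apply: measurableI.
    by apply: measurableX => //; apply: sub_sigma_algebra; case: V_base.
  by rewrite -[_ @^-1` _]setTI; exact: act_measurable.
pose N' := N `|` \bigcup_i M i.
have mM : measurable (\bigcup_i M i) by apply: bigcupT_measurable => i; case: (BM i).
have mN' : measurable N' by exact: measurableU.
have N'0 : mu N' = 0%E.
  rewrite measureU0//; apply/eqP; rewrite -measure_le0.
  apply: (@le_trans _ _ (\sum_(i <oo) mu (M i))%E).
    by apply: measure_sigma_subadditive => // i; case: (BM i).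
  by rewrite eseries0// => i _ _; case: (BM i).
pose phi x : borel (coset_space Gamma) :=
  if `[< N' x >] then coset_pi Gamma 1%g else coset_pi Gamma (h x).
exists phi; last first.
  exists N'; split=> // x; apply: contra_notP => nN'.
  rewrite /= /phi asboolF//; apply: hP => Nx; apply: nN'; by left.
apply: (@measurability _ _ X (borel (coset_space Gamma)) setT phi (@open (coset_space Gamma))) => //.
move=> _ [U oU <-]; rewrite setTI.
have {}oU : open (coset_pi Gamma @^-1` U) by [].
pose I := [set i | closure (V i) `<=` coset_pi Gamma @^-1` U].
rewrite (_ : phi @^-1` U = (N' `&` [set x | U (coset_pi Gamma 1%g)]) `|`
    (~` N' `&` \bigcup_(i in I) B i)).
  apply: measurableU; apply: measurableI => //.
  - have [U1|nU1] := pselect (U (coset_pi Gamma 1%g)).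
      by rewrite (_ : [set _ | _] = setT)//; apply/seteqP; split.
    by rewrite (_ : [set _ | _] = set0)//; apply/seteqP; split.
  - exact: measurableC.
  - by apply: bigcup_measurable => i _; case: (BM i).
apply/seteqP; split=> x; rewrite /= /phi.
- case: asboolP => [N'x U1|nN'x Uh]; [by left|right; split=> //].
  have nNx : ~ N x by move=> Nx; apply: nN'x; left.
  have : (coset_pi Gamma @^-1` U) (h x) by [].
  rewrite (base_open V_base oU) => -[i iU Vhx]; exists i => //.
  have [_ _ _ BE] := BM i; apply/BE; first by move=> Mx; apply: nN'x; right; exists i.
  exists (h x); split=> //=.
  by have /seteqP[_ /(_ (h x) erefl)] := hP x nNx.
- case=> [[N'x U1]|[nN'x [i iU Bx]]]; first by rewrite asboolT.
  rewrite asboolF//.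
  have nNx : ~ N x by move=> Nx; apply: nN'x; left.
  have [_ _ _ /(_ x)BE] := BM i.
  have [g [[Vg _] Yg]] : hit i x by apply/BE => // Mx; apply: nN'x; right; exists i.
  have Ug : U (coset_pi Gamma g) by exact/iU/subset_closure.
  have : return_set act Y x g by [].
  by rewrite (hP x nNx) /= => <-.
Qed.

Hypothesis mu_invariant : invariant_measure act mu.
Context (phi : X -> borel (coset_space Gamma)).
Hypothesis mphi : measurable_fun setT phi.
Hypothesis phiE : {ae mu, forall x, return_set act Y x = [set g | coset_pi Gamma g = phi x]}.

Lemma ae_act_invariant g (Q : X -> Prop) :
  {ae mu, forall x, Q x} -> {ae mu, forall x, Q (act g x)}.
Proof.
move=> [N [mN mN0 QN]]; exists (act g @^-1` N); split.
- by rewrite -[_ @^-1` _]setTI; exact: (measurable_act act_measurable).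
- by rewrite -mN0; exact: mu_invariant.
- by move=> x /= /QN.
Qed.

(** The set Y_(g.x) is Y_x g^-1. *)
Lemma coset_factor_equivariant g : {ae mu, forall x, phi (act g x) = coset_act g (phi x)}.
Proof.
apply: filterS2 phiE (ae_act_invariant g phiE) => x E Eg.
have [k kphi] : exists k, coset_pi Gamma k = phi x by eexists; exact: coset_pi_repr.
have : return_set act Y (act g x) (k * g^-1)%g.
  by apply/(return_set_act act_action); rewrite mulgVK E.
by rewrite Eg /= => <-; rewrite -kphi coset_act_pi.
Qed.

Lemma coset_transverse_factor :
  exists m : probability (borel (coset_space Gamma)) R,
    invariant_measure (@coset_act G Gamma) m /\
    transverse_G_factor act mu Y (@coset_act G Gamma) m [set coset_pi Gamma 1%g] phi.
Proof.
pose phi' : {mfun X >-> borel (coset_space Gamma)} :=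
  HB.pack phi (isMeasurableFun.Build _ _ _ _ phi mphi).
exists (distribution mu phi'); split.
  move=> g A mA; rewrite /= /distribution /pushforward /=.
  have mphiA : measurable (phi @^-1` A) by rewrite -[_ @^-1` _]setTI; exact: mphi.
  rewrite -(mu_invariant g mphiA); apply: ae_eq_measure.
  - rewrite -[X in measurable X]setTI; apply: mphi => //.
    by rewrite -[X in measurable X]setTI; exact: measurable_coset_act.
  - by rewrite -[X in measurable X]setTI; exact: (measurable_act act_measurable).
  - by apply: filterS (coset_factor_equivariant g) => x /= ->.
split; first by split=> //; exact: coset_factor_equivariant.
by apply: filterS phiE => x ->; rewrite return_set_coset.
Qed.

End Factor.

(** * The equality case *)

Section ConstantReturn.
Context (R : realType) (G : topologicalGroupType) (V : nat -> set G).
Hypothesis V_base : precompact_base V.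
Hypothesis G_hausdorff : hausdorff_space G.
Context (mG : {sigma_finite_measure set (borel G) -> \bar R}).
Hypothesis mG_neq0 : mG setT != 0%E.
Hypothesis mG_compact : forall K : set G, compact K -> (mG K < +oo)%E.
Context d (X : measurableType d) (act : G -> X -> X).
Hypothesis act_action : is_action act.
Hypothesis act_measurable :
  measurable_fun setT (fun gx : borel G * X => act gx.1 gx.2).
Context (mu : probability X R) (Y : set X).
Hypothesis Y_cross_section : locally_integrable_cross_section act mu Y.
Context (muY : {sigma_finite_measure set X -> \bar R}).
Hypothesis muY_transverse : transverse_measure mG act mu Y muY.

(** For almost every x and every g in Y_x one has Y_x = L g. At a single such
    x0, replacing g0 by the return k g0, for k in L, gives L k = L. *)
Lemma constant_return_subgroup (L : set G) :
  {ae muY, forall y, return_set act Y y = L} ->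
  exists Gamma : groupClosed G, locally_finite_set [set g | g \in Gamma] /\
    {ae mu, forall x, exists h,
      return_set act Y x = [set g | coset_pi Gamma g = coset_pi Gamma h]}.
Proof.
move=> aeL; have [mY sat lf _] := Y_cross_section.
have muYoo := muY_fin V_base G_hausdorff mG_neq0 mG_compact act_measurable Y_cross_section
  muY_transverse.
have aeL' := ae_transverse_total V_base G_hausdorff mG_neq0 act_measurable mY muYoo
  muY_transverse aeL.
have good : {ae mu, forall x, (exists g, return_set act Y x g) /\
    forall g, return_set act Y x g -> return_set act Y (act g x) = L}.
  apply: filterS2 (sat : {ae mu, forall x, saturation act Y x}) aeL' => x.
  by move=> /(saturationP act_action).
have goodE x g h : return_set act Y x g -> return_set act Y (act g x) = L ->
    L h <-> return_set act Y x (h * g)%g.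
  by move=> Yg <-; exact: return_set_act.
have [x0 [[g0 Yg0] allE]] := ae_probability_ex good.
have LE h := goodE x0 g0 h Yg0 (allE _ Yg0).
have L1 : L 1%g by apply/LE; rewrite mul1g.
have LM g h : L g -> L h <-> L (h * g)%g.
  move=> /LE Yg; rewrite (LE (h * g)%g) -mulgA.
  exact: goodE Yg (allE _ Yg).
have [Gamma GammaE] := subgroup_of_set L1 LM.
have GammaP g : g \in Gamma <-> L g by rewrite GammaE; split=> /asboolP.
exists Gamma; split.
  rewrite (_ : [set g | g \in Gamma] = L); last by apply/seteqP; split=> g /GammaP.
  rewrite -(allE _ Yg0); apply: lf; apply/(saturationP act_action).
  by exists 1%g; rewrite allE.
apply: filterS good => x [[g Yg] xE]; exists g.
have {}xE h := goodE x g h Yg (xE _ Yg).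
apply/seteqP; split=> k /=.
  by move=> Yk; apply/coset_piP/GammaP/xE; rewrite mulgVK.
by move=> /coset_piP/GammaP/xE; rewrite mulgVK.
Qed.
End ConstantReturn.

Local Open Scope ereal_scope.

Theorem theorem1 (R : realType) (G : topologicalGroupType)
    (G_hausdorff : hausdorff_space G)
    (G_locally_compact : locally_compact [set: G])
    (G_second_countable : @second_countable G)
    (mG : {measure set (borel G) -> \bar R})
    (mG_haar : haar_measure mG)
    (G_unimodular : right_invariant mG)
    (d : measure_display) (X : measurableType d)
    (act : G -> X -> X)
    (act_borel : borel_G_space R act)
    (mu : probability X R)
    (mu_invariant : invariant_measure act mu)
    (Y : set X)
    (Y_cross_section : locally_integrable_cross_section act mu Y)
    (muY : {sigma_finite_measure set X -> \bar R})
    (muY_transverse : transverse_measure mG act mu Y muY)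
    (mu2 : {sigma_finite_measure set (X * X)%type -> \bar R})
    (mu2_intersection : intersection_measure mG act Y muY mu2) :
  intensity Y muY <= intersection_covolume mu2 /\
  (intersection_covolume mu2 = intensity Y muY <->
   exists Gamma : groupClosed G,
     lattice Gamma R /\
     exists m : probability (borel (coset_space Gamma)) R,
       invariant_measure (@coset_act G Gamma) m /\
       exists phi : X -> borel (coset_space Gamma),
         transverse_G_factor act mu Y
           (@coset_act G Gamma) m [set coset_pi Gamma 1%g] phi).
Proof.
have [V V_base] := precompact_base_exists G_hausdorff G_locally_compact G_second_countable.
have [_ mG_neq0 mG_compact] := mG_haar.
have mG_sigma_finite : sigma_finite setT mG.
  exists (fun i => closure (V i)).
    apply/seteqP; split=> // g _; have [i Vg] := base_cover V_base g.
    by exists i => //; exact: subset_closure.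
  move=> i; split; last by apply: mG_compact; case: V_base.
  rewrite -[closure (V i)]setCK; apply: measurableC; apply: sub_sigma_algebra.
  exact/closed_openC/closed_closure.
pose mG' := sigma_finite_pack mG_sigma_finite.
have [_ act_action act_measurable] := act_borel.
have [mu2_conull _ mu2_transverse] := mu2_intersection.
have muY_transverse' : transverse_measure mG' act mu Y muY by exact: muY_transverse.
have mu2_transverse' : transverse_measure mG' (diag_act act) mu2 (Y `*` Y) (muY \x muY).
  exact: mu2_transverse.
have [mY _ _ _] := Y_cross_section.
split; first exact: (intensity_le_covolume V_base G_hausdorff (mG := mG') mG_neq0 mG_compact
  act_action act_measurable Y_cross_section muY_transverse' mu2_transverse').
split=> [covol_eq|[Gamma [_ [m [_ [phi [_ phiE]]]]]]].
  have [L aeL] := equality_return_ae_constant V_base G_hausdorff (mG := mG') mG_neq0 mG_compact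
    act_action act_measurable Y_cross_section muY_transverse' mu2_transverse' covol_eq.
  have [Gamma [lfGamma aeGamma]] := constant_return_subgroup V_base G_hausdorff (mG := mG')
    mG_neq0 mG_compact act_action act_measurable Y_cross_section muY_transverse' aeL.
  have [phi mphi phiE] := coset_factor_measurable V_base act_measurable mY aeGamma.
  have [m [m_inv m_factor]] := coset_transverse_factor act_action act_measurable mu_invariant
    mphi phiE.
  exists Gamma; split; last by exists m; split=> //; exists phi.
  split; first exact: discrete_of_locally_finite V_base G_hausdorff lfGamma.
  have m_neq0 : m setT != 0 by rewrite probability_setT onee_neq0.
  have m_fin : m setT < +oo by rewrite probability_setT ltry.
  by exists m.
apply: (equality_of_return_eq V_base G_hausdorff (mG := mG') mG_neq0 mG_compact act_action
  act_measurable Y_cross_section muY_transverse' mu2_conull mu2_transverse').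
have {}phiE : {ae mu, forall x, return_set act Y x = [set g | coset_pi Gamma g = phi x]}.
  by apply: filterS phiE => x ->; rewrite return_set_coset.
have := ae_mu2_coordinates V_base G_hausdorff (mG := mG') mG_neq0 mG_compact act_action
  act_measurable Y_cross_section muY_transverse' mu2_conull mu2_transverse' phiE.
apply: filterS2 (mu2_common_return act_action mu2_conull) => p [g [Yg1 Yg2]] [E1 E2].
move: Yg1 Yg2; rewrite E1 E2 /= => e1 e2.
by rewrite -e1 -e2.
Qed.
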